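(* Let $G$ be a group, let $K$ be a subfield of $\mathbb{C}$ and let $0 \ne \alpha \in KG$. Then there exists $\epsilon > 0$ such that $\operatorname{rk}(\theta_*\alpha) > \epsilon$ for every automorphism $\theta$ of $K$.
   Context: If $\theta$ is an automorphism of the field $K$, then $\theta_*$ denotes the induced automorphism of the group algebra $KG$ given by $\theta_*(\sum_g a_g g) = \sum_g \theta(a_g) g$. $\mathcal{N}(G)$ denotes the group von Neumann algebra of $G$: the algebra of bounded operators on $\ell^2(G)$ (the Hilbert space with orthonormal basis $G$) commuting with the right translation action of $G$. It contains $\mathbb{C}G$, acting by left multiplication. An element $\alpha \in \mathcal{N}(G)$ can be written $\alpha = \sum_{g \in G} \alpha_g g$ with $\alpha_g \in \mathbb{C}$ (the coefficients of $\alpha$ applied to the basis vector $1 \in G$), and its trace is $\operatorname{tr}\alpha = \alpha_1$, the coefficient of the identity element. $\mathcal{U}(G)$ denotes the algebra of unbounded operators on $\ell^2(G)$ affiliated to $\mathcal{N}(G)$, i.e. closed densely defined operators commuting with the right translation action of $G$, with sum and product being the closures of the usual sum and composition, and with involution $*$ the adjoint. Thus $KG \subseteq \mathbb{C}G \subseteq \mathcal{N}(G) \subseteq \mathcal{U}(G)$. For each $\alpha \in \mathcal{U}(G)$ there is a unique projection $e \in \mathcal{N}(G)$ (so $e = e^2 = e^*$) such that $\alpha\,\mathcal{U}(G) = e\,\mathcal{U}(G)$, and the rank of $\alpha$ is $\operatorname{rk}(\alpha) = \operatorname{tr}(e) \in [0,1]$. *)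

(* Defs.v *)
From HB Require Import structures.
From mathcomp Require Import all_boot all_order all_algebra finmap.
From mathcomp Require Import complex ring lra.
From mathcomp Require Import boolp classical_sets functions cardinality fsbigop.
From mathcomp Require Import reals ereal topology normedtype numfun esum.

Set Implicit Arguments.
Unset Strict Implicit.
Unset Printing Implicit Defensive.

Import Order.TTheory GRing.Theory Num.Theory.
Import numFieldNormedType.Exports.
Import ComplexField.Normc.

Local Open Scope ring_scope.
Local Open Scope classical_set_scope.

Section SquareSummable.
Variables (R : realType) (G : groupType).
Implicit Types (x y : G -> R[i]).

Definition sqsum x : \bar R := \esum_(g in [set: G]) (normc (x g) ^+ 2)%:E.

Definition sqsummable : {pred G -> R[i]} := fun x => (sqsum x < +oo)%E.

Lemma sqsum_ge0 x : (0 <= sqsum x)%E.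
Proof. by apply: esum_ge0 => g _; rewrite lee_fin sqr_ge0. Qed.

Lemma esum_scale (f : G -> \bar R) (k : R) : (forall g, 0 <= f g)%E -> 0 <= k ->
  (\esum_(g in [set: G]) (k%:E * f g) = k%:E * \esum_(g in [set: G]) f g)%E.
Proof.
move=> f0 k0; rewrite /esum -ereal_supZl //; last first.
  by apply/set0P; exists (\sum_(g \in set0) f g), set0 => //; exact: fsets_set0.
congr ereal_sup; apply/seteqP; split => z /=.
  move=> [A finA <-]; exists (\sum_(g \in A) f g); first by exists A.
  by rewrite ge0_mule_fsumr.
move=> [_ [A finA <-] <-]; exists A => //.
by rewrite ge0_mule_fsumr.
Qed.

Lemma sqsumZ (c : R[i]) x :
  sqsum (fun g => c * x g) = ((normc c ^+ 2)%:E * sqsum x)%E.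
Proof.
rewrite /sqsum -esum_scale ?sqr_ge0 //; last first.
  by move=> g; rewrite lee_fin sqr_ge0.
by apply: eq_esum => g _; rewrite normcM exprMn EFinM.
Qed.

Lemma sqsumD (t : R) x y : 0 < t ->
  (sqsum (fun g => x g + y g)%R <=
     (1 + t)%:E * sqsum x + (1 + t^-1)%:E * sqsum y)%E.
Proof.
move=> t0; have ti0 : 0 < t^-1 by rewrite invr_gt0.
rewrite /sqsum -!esum_scale; first last.
- by rewrite addr_ge0 // ltW.
- by move=> g; rewrite lee_fin sqr_ge0.
- by rewrite addr_ge0 // ltW.
- by move=> g; rewrite lee_fin sqr_ge0.
rewrite -esumD; first last.
- by move=> g _; rewrite -EFinM lee_fin mulr_ge0 ?sqr_ge0 // addr_ge0 // ltW.
- by move=> g _; rewrite -EFinM lee_fin mulr_ge0 ?sqr_ge0 // addr_ge0 // ltW.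
apply: le_esum => g _; rewrite -!EFinM -EFinD lee_fin.
have nD := le_normcD (x g) (y g).
have n0 (z : R[i]) : 0 <= normc z by case: z => a b; exact: sqrtr_ge0.
apply: (@le_trans _ _ ((normc (x g) + normc (y g)) ^+ 2)).
  by rewrite lerXn2r // nnegrE ?addr_ge0.
set a := normc _; set b := normc _.
suff : 0 <= t * (a - t^-1 * b) ^+ 2.
  have -> : t * (a - t^-1 * b) ^+ 2 =
      t * a ^+ 2 - (t * t^-1) * a * b *+ 2 + (t * t^-1) * t^-1 * b ^+ 2.
    by ring.
  rewrite mulfV ?gt_eqF // => h; rewrite sqrrD.
  rewrite -subr_ge0; move: h; congr (0 <= _); ring.
by rewrite mulr_ge0 ?sqr_ge0 // ltW.
Qed.

Lemma sqsummable_submod_closed : submod_closed sqsummable.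
Proof.
split=> [|c x y].
  rewrite /in_mem /= /sqsummable /sqsum esum1 ?ltry // => g _.
  by rewrite normc0 expr0n.
rewrite /in_mem /= /sqsummable => xfin yfin.
apply: (@le_lt_trans _ _ ((1 + 1)%:E * sqsum (fun g => c * x g)%R +
                          (1 + 1^-1)%:E * sqsum y)%E).
  exact: (sqsumD (fun g => c * x g) y ltr01).
rewrite sqsumZ lte_add_pinfty // ?lte_mul_pinfty // ?mule_ge0 ?sqsum_ge0 //;
  by rewrite ?lee_fin ?addr_ge0 ?sqr_ge0 ?invr_ge0.
Qed.

HB.instance Definition _ :=
  GRing.isSubmodClosed.Build R[i] (G -> R[i]) sqsummable
    sqsummable_submod_closed.

Record ell2 := Ell2 { ell2_fun :> G -> R[i]; _ : ell2_fun \in sqsummable }.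

HB.instance Definition _ := [isSub for ell2_fun].
HB.instance Definition _ := [Choice of ell2 by <:].
HB.instance Definition _ := [SubChoice_isSubLmodule of ell2 by <:].

Definition ell2_norm (x : ell2) : R[i] := (Num.sqrt (fine (sqsum x)))%:C%C.


Lemma sqsum_fin_num (x : ell2) : sqsum x \is a fin_num.
Proof. by rewrite ge0_fin_numE ?sqsum_ge0 //; case: x. Qed.

Lemma ell2_normZ (c : R[i]) (x : ell2) :
  ell2_norm (c *: x) = `|c| * ell2_norm x.
Proof.
rewrite /ell2_norm; have -> : sqsum (c *: x) = ((normc c ^+ 2)%:E * sqsum x)%E.
  exact: sqsumZ.
have n0 : 0 <= normc c by case: c => a b; exact: sqrtr_ge0.
rewrite fineM ?sqsum_fin_num //= sqrtrM ?sqr_ge0 // sqrtr_sqr ger0_norm //.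
by rewrite rmorphM.
Qed.

Lemma ell2_norm0_eq0 (x : ell2) : ell2_norm x = 0 -> x = 0.
Proof.
move=> [/eqP]; rewrite sqrtr_eq0 => x0; apply/val_inj/funext => g /=.
apply/eq0_normc/eqP; rewrite -sqrf_eq0 eq_le sqr_ge0 andbT -lee_fin.
apply: (@le_trans _ _ (sqsum x)); last first.
  by rewrite -(fineK (sqsum_fin_num x)) lee_fin.
apply: esum_ge; exists [set g]; first by split.
by rewrite fsbig_set1.
Qed.

Lemma ell2_normD (x y : ell2) :
  ell2_norm (x + y) <= ell2_norm x + ell2_norm y.
Proof.
have [x0|xn0] := eqVneq (ell2_norm x) 0.
  by rewrite (ell2_norm0_eq0 x0) add0r lerDr lecR sqrtr_ge0.
have [y0|yn0] := eqVneq (ell2_norm y) 0.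
  by rewrite (ell2_norm0_eq0 y0) addr0 lerDl lecR sqrtr_ge0.
have sq (z : ell2) : fine (sqsum z) = Num.sqrt (fine (sqsum z)) ^+ 2.
  by rewrite sqr_sqrtr // fine_ge0 // sqsum_ge0.
have pos (z : ell2) : ell2_norm z != 0 -> 0 < Num.sqrt (fine (sqsum z)).
  move=> zn0; rewrite lt_def sqrtr_ge0 andbT; apply: contra zn0 => /eqP z0.
  by rewrite /ell2_norm z0.
rewrite /ell2_norm -rmorphD lecR.
have := pos _ xn0; have := pos _ yn0; move: (sq x) (sq y).
set a := Num.sqrt _; set b := Num.sqrt _ => xa yb b0 a0.
have ab0 : 0 <= a + b by apply: addr_ge0; exact: ltW.
rewrite -[leRHS](ger0_norm ab0) -sqrtr_sqr.
apply: ler_wsqrtr; rewrite -lee_fin fineK ?sqsum_fin_num //.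
have := sqsumD x y (divr_gt0 b0 a0).
rewrite -(fineK (sqsum_fin_num x)) -(fineK (sqsum_fin_num y)) xa yb.
rewrite -!EFinM -EFinD.
suff -> : (1 + b / a) * a ^+ 2 + (1 + (b / a)^-1) * b ^+ 2 = (a + b) ^+ 2.
  exact.
by field; rewrite !gt_eqF.
Qed.

HB.instance Definition _ := @Lmodule_isNormed.Build R[i] ell2
  ell2_norm ell2_normD ell2_normZ ell2_norm0_eq0.

End SquareSummable.

Section Operators.
Variables (R : realType) (G : groupType).
Local Notation H := (ell2 R G).
Implicit Types (x y : H) (g h : G).

(* [rsum] and [csum] are meaningful on absolutely summable families only. *)
Definition rsum (f : G -> R) : R :=
  fine (\esum_(g in [set: G]) (f^\+ g)%:E) -
  fine (\esum_(g in [set: G]) (f^\- g)%:E).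

Definition csum (f : G -> R[i]) : R[i] :=
  (rsum (fun g => complex.Re (f g)) +i* rsum (fun g => complex.Im (f g)))%C.

Definition ell2_dot x y : R[i] := csum (fun g => x g * conjc (y g)).

Lemma sqsummable_reindex (s : G -> G) x : bijective s ->
  (fun h => x (s h)) \in @sqsummable R G.
Proof.
move=> sbij; rewrite /in_mem /= /sqsummable /sqsum.
have s_bij : set_bij [set: G] [set: G] s by rewrite setTT_bijective.
rewrite -(reindex_esum [set: G] [set: G] s
            (fun h => (normc (x h) ^+ 2)%:E) s_bij).
by case: x.
Qed.

Lemma mulg_bijl g : bijective (fun h : G => (g^-1 * h)%g).
Proof.
by exists (fun h => (g * h)%g) => h; rewrite mulgA ?mulgV ?mulVg mul1g.
Qed.

Lemma mulg_bijr g : bijective (fun h : G => (h * g^-1)%g).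
Proof.
by exists (fun h => (h * g)%g) => h; rewrite -mulgA ?mulgV ?mulVg mulg1.
Qed.

(* [ltrans g] and [rtrans g] extend the permutations [h |-> g * h] and
   [h |-> h * g] of the orthonormal basis [G]. *)
Definition ltrans g x : H := Ell2 (sqsummable_reindex x (mulg_bijl g)).

Definition rtrans g x : H := Ell2 (sqsummable_reindex x (mulg_bijr g)).

Lemma sqsummable_delta g :
  (fun h => (h == g)%:R : R[i]) \in @sqsummable R G.
Proof.
rewrite /in_mem /= /sqsummable /sqsum.
suff -> : \esum_(h in [set: G]) (normc ((h == g)%:R : R[i]) ^+ 2)%:E =
    \esum_(h in [set g]) (1%:E : \bar R) by rewrite esum_set1 ?lee_fin ?ltry.
rewrite [RHS]esum_mkcond; apply: eq_esum => h _.
case: (eqVneq h g) => [->|hg]; first by rewrite mem_set // normc1 expr1n.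
by rewrite memNset ?normc0 ?expr0n // => /eqP; exact/negP.
Qed.

Definition ell2_basis g : H := Ell2 (sqsummable_delta g).

Definition group_vN (f : H -> H) : Prop :=
  [/\ linear f,
      exists M : R, forall x, `|f x| <= M%:C%C * `|x| &
      forall g x, f (rtrans g x) = rtrans g (f x)].

Definition vN_tr (f : H -> H) : R[i] := f (ell2_basis 1%g) 1%g.

Definition vN_projection (e : H -> H) : Prop :=
  [/\ group_vN e, forall x, e (e x) = e x &
      forall x y, ell2_dot (e x) y = ell2_dot x (e y)].

(* Unbounded operators are represented by their graphs: [affiliated T] says
   that [T] is the graph of a closed densely defined linear operator commuting
   with right translations. *)
Definition affiliated (T : set (H * H)) : Prop :=
  [/\ T 0 /\ (forall (c : R[i]) p q, T p -> T q -> T (c *: p + q)),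
      forall x y z, T (x, y) -> T (x, z) -> y = z,
      dense [set x | exists y, T (x, y)],
      closed T &
      forall g x y, T (x, y) -> T (rtrans g x, rtrans g y)].

Definition opgraph (f : H -> H) : set (H * H) := [set p | p.2 = f p.1].

(* The product of affiliated operators: first [T], then [S]. *)
Definition aff_mul (S T : set (H * H)) : set (H * H) :=
  closure [set p | exists2 y, T (p.1, y) & S (y, p.2)].

Definition aff_rideal (S : set (H * H)) : set (set (H * H)) :=
  [set aff_mul S T | T in affiliated].

Definition range_projection (S : set (H * H)) (e : H -> H) : Prop :=
  vN_projection e /\ aff_rideal S = aff_rideal (opgraph e).

(* There is exactly one [e] with [range_projection S e] if [S] is affiliated;
   the value 0 is used when there is none. *)
Definition rk (S : set (H * H)) : R[i] :=
  vN_tr (xget (fun=> 0) [set e | range_projection S e]).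

End Operators.

Section Subfield.
Variables (R : realType) (K : divringClosed R[i]).

Record subfield := Subfield { subfield_val :> R[i]; _ : subfield_val \in K }.

HB.instance Definition _ := [isSub for subfield_val].
HB.instance Definition _ := [Choice of subfield by <:].
HB.instance Definition _ := [SubChoice_isSubComUnitRing of subfield by <:].
HB.instance Definition _ :=
  [SubComUnitRing_isSubIntegralDomain of subfield by <:].
HB.instance Definition _ := [SubIntegralDomain_isSubField of subfield by <:].

End Subfield.

Definition group_algebra (K : fieldType) (G : groupType) : Type :=
  {fsfun G -> K with 0}.

Definition galg_map (K : fieldType) (G : groupType) (theta : K -> K)
    (a : group_algebra K G) : group_algebra K G :=
  [fsfun g in finsupp a => theta (a g)].

Definition galg_act (R : realType) (K : divringClosed R[i]) (G : groupType)
    (a : group_algebra (subfield K) G) (x : ell2 R G) : ell2 R G :=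
  \sum_(g <- finsupp a) subfield_val (a g) *: ltrans g x.

(* Main.v *)
Require Import Defs.
From HB Require Import structures.
From mathcomp Require Import all_boot all_order all_algebra finmap.
From mathcomp Require Import complex ring lra.
From mathcomp Require Import boolp classical_sets functions cardinality fsbigop.
From mathcomp Require Import reals ereal topology normedtype numfun esum.

Import Order.TTheory GRing.Theory Num.Theory.
Import numFieldNormedType.Exports.
Import ComplexField.Normc.

Local Open Scope ring_scope.
Local Open Scope classical_set_scope.

Set Implicit Arguments.
Unset Strict Implicit.
Unset Printing Implicit Defensive.

(** A nonzero element [a] of the group algebra whose support has [n] elements
satisfies [1 <= n * rk a].  An automorphism of the field does not enlarge the
support and keeps the element nonzero, so [1 / (n + 1)] is a uniform strict
lower bound.

The inequality is an uncertainty principle ([rank_lower_bound]).  Let [e] be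
the range projection of [a], let [delta_g] be the basis vector at [g] and let
[x = a delta_1], the vector of coefficients of [a].  Then [e x = x], and [e]
commutes with right translations, so that Cauchy-Schwarz gives, for every [g],
[|x_g|^2 = |<x, e delta_g>|^2 <= |x|^2 |e delta_g|^2 = |x|^2 tr e].  Summing
over the support of [a] gives [|x|^2 <= n |x|^2 tr e].

What remains is the existence of [e], without which [rk] would be the default
value 0: the projection [e] onto the closure of the range of [a] generates the
same right ideal of affiliated operators as [a]
([aff_rideal_range_projection]).  The proof represents affiliated operators as
fractions.  The graph of an affiliated operator is the closure of
[{(A z, B z)}] for some [A], [B] in N(G) with [A] of dense range
([graph_fraction]); conversely such a closure is the graph of an affiliated
operator ([fraction_affiliated]); and an Ore condition ([ore_condition]) moves
[e B] to the form [a C] after composition with an operator of dense range.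

These facts rest on the von Neumann dimension of closed invariant subspaces
of [l^2(G) + l^2(G)].  The trace is faithful, so a proper closed
subspace has smaller dimension ([vN_dim_inj]); and an operator and its adjoint have kernels of the same dimension
([vN_dim_ker_adjoint]).  For the latter, scale [W] to a contraction: the
powers of [1 - W* W] and of [1 - W W*] have the same trace and converge
strongly to the projections onto the two kernels.

Inner products are real-valued throughout, the real part of the Hermitian one;
it determines the latter, since [Im <x, y> = Re <x, i y>]. *)

(** * Absolutely convergent sums *)

Section Sums.
Variables (R : realType) (G : groupType).
Implicit Types (f a b : G -> R).

Definition rsummable f := summable [set: G] (EFin \o f).

Lemma rsummable_le f a : (forall g, `|f g| <= a g) -> rsummable a -> rsummable f.
Proof.
move=> fa; apply: le_lt_trans; apply: le_esum => g _ /=.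
by rewrite lee_fin (le_trans (fa g)) // ler_norm.
Qed.

Lemma rsummableD a b : rsummable a -> rsummable b -> rsummable (fun g => a g + b g).
Proof. by move=> sa sb; exact: summableD sa sb. Qed.

Lemma rsummableN f : rsummable f -> rsummable (fun g => `|f g|).
Proof.
by apply: le_lt_trans; apply: le_esum => g _ /=; rewrite normr_id.
Qed.

Lemma rsummableZ (k : R) a : rsummable a -> rsummable (fun g => k * a g).
Proof.
rewrite /rsummable /summable => sa.
rewrite (eq_esum (b := fun g => (`|k|%:E * `|(EFin \o a) g|)%E)); last first.
  by move=> g _; rewrite /= normrM EFinM.
rewrite esum_scale //.
by apply: lte_mul_pinfty; rewrite ?lee_fin.
Qed.

Lemma rsummable_sqr (x : ell2 R G) : rsummable (fun g => normc (x g) ^+ 2).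
Proof.
have : (sqsum x < +oo)%E by case: x.
apply: le_lt_trans; apply: le_esum => g _ /=.
by rewrite ger0_norm ?sqr_ge0.
Qed.

Definition psum a : R := fine (\esum_(g in [set: G]) (a g)%:E).

Lemma psum_fin a : rsummable a -> (forall g, 0 <= a g) ->
  \esum_(g in [set: G]) (a g)%:E \is a fin_num.
Proof.
move=> sa a0; rewrite ge0_fin_numE; last first.
  by apply: esum_ge0 => g _; rewrite lee_fin.
by apply: le_lt_trans sa; apply: le_esum => g _; rewrite lee_fin ler_norm.
Qed.

Lemma psumD a b : rsummable a -> rsummable b ->
  (forall g, 0 <= a g) -> (forall g, 0 <= b g) ->
  psum (fun g => a g + b g) = psum a + psum b.
Proof.
move=> sa sb a0 b0; rewrite /psum -fineD ?psum_fin // -esumD //;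
  by move=> g _; rewrite lee_fin.
Qed.

(** The decomposition of a function as a difference of nonnegative ones is
irrelevant to its sum; the additivity of [rsum] follows. *)
Lemma rsum_sub a b : rsummable a -> rsummable b ->
  (forall g, 0 <= a g) -> (forall g, 0 <= b g) ->
  rsum (fun g => a g - b g) = psum a - psum b.
Proof.
move=> sa sb a0 b0.
have sab : rsummable (fun g => a g - b g) by exact: summableB sa sb.
have spos : rsummable (fun g => a g - b g)^\+.
  apply: rsummable_le (rsummableN sab) => g; rewrite ger0_norm // /funrpos.
  by rewrite ge_max normr_ge0 ler_norm.
have sneg : rsummable (fun g => a g - b g)^\-.
  apply: rsummable_le (rsummableN sab) => g; rewrite ger0_norm // /funrneg.
  by rewrite ge_max normr_ge0 -normrN ler_norm.
rewrite /rsum /psum -!fineB ?psum_fin //; congr fine.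
rewrite -(esumB sa sb) => [|g _|g _]; rewrite ?lee_fin //.
rewrite -[(_ \- _)%E]/(EFin \o (fun g => a g - b g)).
by rewrite funerpos funerneg.
Qed.

Lemma rsum_posneg f : rsum f = psum f^\+ - psum f^\-.
Proof. by []. Qed.

Lemma rsummable_pos f : rsummable f -> rsummable f^\+ /\ rsummable f^\-.
Proof.
move=> /rsummableN sf; split; apply: rsummable_le sf => g; rewrite ger0_norm //.
  by rewrite ge_max normr_ge0 ler_norm.
by rewrite ge_max normr_ge0 -normrN ler_norm.
Qed.

Lemma funrpos_sub f g : f g = f^\+ g - f^\- g.
Proof. by rewrite -[in LHS](funrposBneg f). Qed.

Lemma rsumD f1 f2 : rsummable f1 -> rsummable f2 ->
  rsum (fun g => f1 g + f2 g) = rsum f1 + rsum f2.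
Proof.
move=> s1 s2; have [p1 n1] := rsummable_pos s1; have [p2 n2] := rsummable_pos s2.
have -> : (fun g => f1 g + f2 g) =
    (fun g => (f1^\+ g + f2^\+ g) - (f1^\- g + f2^\- g)).
  by apply/funext => g; rewrite (funrpos_sub f1) (funrpos_sub f2); ring.
rewrite rsum_sub ?psumD // ?(rsum_posneg f1) ?(rsum_posneg f2); first by ring.
- exact: rsummableD.
- exact: rsummableD.
- by move=> g; rewrite addr_ge0.
- by move=> g; rewrite addr_ge0.
Qed.

Lemma rsum_ge0E f : (forall g, 0 <= f g) -> rsum f = psum f.
Proof.
move=> f0; rewrite rsum_posneg.
have -> : f^\+ = f by apply/funext => g; rewrite /funrpos; apply/max_idPl.
have -> : f^\- = fun=> 0.
  by apply/funext => g; rewrite /funrneg; apply/max_idPr; rewrite oppr_le0.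
by rewrite [X in _ - X]/psum esum1 // subr0.
Qed.

Lemma psumZ (k : R) a : 0 <= k -> rsummable a -> (forall g, 0 <= a g) ->
  psum (fun g => k * a g) = k * psum a.
Proof.
move=> k0 sa a0; rewrite /psum.
rewrite (eq_esum (b := fun g => (k%:E * (a g)%:E)%E)) //.
by rewrite esum_scale // fineM ?psum_fin.
Qed.

Lemma rsumZ (k : R) f : rsummable f -> rsum (fun g => k * f g) = k * rsum f.
Proof.
move=> sf; have [sp sn] := rsummable_pos sf.
have [k0|/ltW k0] := leP 0 k.
  have -> : (fun g => k * f g) = (fun g => k * f^\+ g - k * f^\- g).
    by apply/funext => g; rewrite (funrpos_sub f); ring.
  rewrite rsum_sub ?psumZ // ?(rsum_posneg f); first (by ring);
  by [exact: rsummableZ | move=> g; rewrite mulr_ge0].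
have nk0 : 0 <= - k by rewrite oppr_ge0.
have -> : (fun g => k * f g) = (fun g => - k * f^\- g - - k * f^\+ g).
  by apply/funext => g; rewrite (funrpos_sub f); ring.
rewrite rsum_sub ?psumZ // ?(rsum_posneg f); first (by ring);
by [exact: rsummableZ | move=> g; rewrite mulr_ge0].
Qed.

Lemma rsum_reindex (s : G -> G) f : bijective s ->
  rsum (fun g => f (s g)) = rsum f.
Proof.
move=> bs; rewrite /rsum.
have s_bij : set_bij [set: G] [set: G] s by rewrite setTT_bijective.
by rewrite (reindex_esum [set: G] [set: G] s (fun g => (f^\+ g)%:E) s_bij)
  (reindex_esum [set: G] [set: G] s (fun g => (f^\- g)%:E) s_bij).
Qed.

Lemma rsum_single f g : (forall h, h != g -> f h = 0) -> rsum f = f g.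
Proof.
have single a : (forall h, 0 <= a h) -> (forall h, h != g -> a h = 0) ->
    psum a = a g.
  move=> a0 ag; rewrite /psum.
  suff -> : \esum_(h in [set: G]) (a h)%:E = (a g)%:E by [].
  have <- : \esum_(h in [set g]) (a h)%:E = (a g)%:E.
    by rewrite esum_set1 // lee_fin.
  rewrite [RHS]esum_mkcond; apply: eq_esum => h _.
  case: (eqVneq h g) => [->|hg]; first by rewrite mem_set.
  by rewrite memNset ?ag // => /eqP; exact/negP.
move=> fg; rewrite rsum_posneg !single -?funrpos_sub // => h /fg fh.
  by rewrite /funrneg fh oppr0 maxxx.
by rewrite /funrpos fh maxxx.
Qed.

End Sums.

(** * The real inner product of square-summable functions *)

Section RealInnerProduct.
Variables (R : realType) (G : groupType).
Local Notation H := (ell2 R G).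
Implicit Types (x y z : H) (g h : G).

(** The real inner product of the complex plane. *)
Definition cdot (z w : R[i]) : R := complex.Re (z * conjc w).

Lemma cdotE (z w : R[i]) : cdot z w =
  complex.Re z * complex.Re w + complex.Im z * complex.Im w.
Proof. by case: z => a b; case: w => c d; rewrite /cdot /=; ring. Qed.

Lemma normc_sqr (z : R[i]) : normc z ^+ 2 = complex.Re z ^+ 2 + complex.Im z ^+ 2.
Proof. by case: z => a b; rewrite /= sqr_sqrtr // addr_ge0 // sqr_ge0. Qed.

Definition rdot x y : R := rsum (fun g => cdot (x g) (y g)).

Lemma rsummable_cdot x y : rsummable (fun g => cdot (x g) (y g)).
Proof.
apply: rsummable_le (rsummableD (rsummable_sqr x) (rsummable_sqr y)) => g.
rewrite !normc_sqr cdotE; case: (x g) => a b; case: (y g) => c d /=.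
rewrite ler_norml; apply/andP; split.
  by have := sqr_ge0 (a + c); have := sqr_ge0 (b + d);
    have := sqr_ge0 (a - c); have := sqr_ge0 (b - d); nra.
by have := sqr_ge0 (a + c); have := sqr_ge0 (b + d);
    have := sqr_ge0 (a - c); have := sqr_ge0 (b - d); nra.
Qed.

Lemma rdotC x y : rdot x y = rdot y x.
Proof. by congr rsum; apply/funext => g; rewrite !cdotE; ring. Qed.

Lemma rdotDl x y z : rdot (x + y) z = rdot x z + rdot y z.
Proof.
rewrite /rdot -rsumD; try exact: rsummable_cdot.
congr rsum; apply/funext => g; rewrite !cdotE.
rewrite -[(x + y) g]/(x g + y g).
by case: (x g) => a b; case: (y g) => c d /=; ring.
Qed.

Lemma rdotZ (c : R[i]) x y : rdot (c *: x) y = rdot x (conjc c *: y).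
Proof.
congr rsum; apply/funext => g; rewrite !cdotE.
rewrite -[(_ *: x) g]/(c * x g) -[(_ *: y) g]/(conjc c * y g).
by case: c => a b; case: (x g) => c d; case: (y g) => e f /=; ring.
Qed.

Lemma rdotZr (r : R) x y : rdot (r%:C%C *: x) y = r * rdot x y.
Proof.
rewrite /rdot -rsumZ; last exact: rsummable_cdot.
congr rsum; apply/funext => g; rewrite !cdotE.
rewrite -[(_ *: x) g]/(r%:C%C * x g).
by case: (x g) => c d /=; ring.
Qed.

Lemma rdotxx x : rdot x x = fine (sqsum x).
Proof.
rewrite /rdot rsum_ge0E; last first.
  by move=> g; rewrite cdotE addr_ge0 // -expr2 sqr_ge0.
congr fine; apply: eq_esum => g _; congr (_%:E).
by rewrite cdotE normc_sqr !expr2.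
Qed.

Lemma rdot_ge0 x : 0 <= rdot x x.
Proof. by rewrite rdotxx fine_ge0 // sqsum_ge0. Qed.

Lemma rdot_eq0 x : rdot x x = 0 -> x = 0.
Proof.
by rewrite rdotxx => x0; apply: ell2_norm0_eq0; rewrite /ell2_norm x0 sqrtr0.
Qed.

(** Scalar multiples of basis vectors recover a coordinate together with
its imaginary part, although the form is real-valued. *)
Lemma rdot_basis (c : R[i]) x g : rdot x (c *: ell2_basis R g) = cdot (x g) c.
Proof.
have bE h : cdot (x h) ((c *: ell2_basis R g) h) = cdot (x h) (c * (h == g)%:R).
  by [].
rewrite /rdot (rsum_single (g := g)); first by rewrite bE eqxx mulr1.
by move=> h /negPf hg; rewrite bE hg mulr0 cdotE /= !mulr0 addr0.
Qed.

Lemma rtrans_unitary g x y : rdot (rtrans g x) y = rdot x (rtrans g^-1%g y).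
Proof.
rewrite /rdot -[RHS](rsum_reindex _ (mulg_bijr g)).
congr rsum; apply/funext => h /=; congr (cdot _ (y _)).
by rewrite invgK -mulgA mulVg mulg1.
Qed.

End RealInnerProduct.

(** * Completeness *)

Lemma real_cauchy_cvg (R : realType) (f : nat -> R) :
  (forall e : R, 0 < e -> exists N, forall m n, (N <= m)%N -> (N <= n)%N ->
    `|f m - f n| < e) -> cvgn f.
Proof.
move=> fC; apply/cauchy_cvgP/cauchy_ballP => e e0.
have [N HN] := fC e e0.
exists (f @` [set n | (N <= n)%N], f @` [set n | (N <= n)%N]) => /=.
  by split; exists N => // n Nn; exists n.
case=> a b [/= [m Nm <-] [n Nn <-]].
by rewrite -ball_normE /=; exact: HN.
Qed.

Section Completeness.
Variables (R : realType) (G : groupType).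
Local Notation H := (ell2 R G).

Lemma sum_normc_le_rdot (x : H) (s : seq G) : uniq s ->
  \sum_(g <- s) normc (x g) ^+ 2 <= rdot x x.
Proof.
move=> us; rewrite rdotxx -lee_fin fineK ?sqsum_fin_num //.
apply: esum_ge; exists [set` s]; first by split => //; exact: finite_seq.
by rewrite -fsbig_seq // sumEFin.
Qed.

Lemma sqsum_le (f : G -> R[i]) (M : R) :
  (forall s : seq G, uniq s -> \sum_(g <- s) normc (f g) ^+ 2 <= M) ->
  (sqsum f <= M%:E)%E.
Proof.
move=> fM; apply: ge_ereal_sup => _ [A [finA _] <-].
by rewrite fsbig_finite //= sumEFin lee_fin; apply: fM; exact: fset_uniq.
Qed.

(** The limit is taken coordinatewise. For a finite set of coordinates the
Cauchy bound passes to the limit, and the sum is the supremum of the finite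
sums. *)
Lemma rdot_complete (u : nat -> H) :
  (forall e : R, 0 < e -> exists N, forall m n, (N <= m)%N -> (N <= n)%N ->
    rdot (u m - u n) (u m - u n) < e) ->
  exists l, forall e : R, 0 < e -> exists N, forall n, (N <= n)%N ->
    rdot (u n - l) (u n - l) < e.
Proof.
move=> uC.
have uE m n g : (u m - u n) g = u m g - u n g by [].
have Rc g : cvgn (fun n => complex.Re (u n g)).
  apply: real_cauchy_cvg => e e0; have [N HN] := uC (e ^+ 2) (exprn_gt0 2 e0).
  exists N => m n Nm Nn; rewrite -(ltr_pXn2r (n := 2)) ?nnegrE ?(ltW e0) //.
  apply: le_lt_trans (HN m n Nm Nn).
  apply: le_trans (@sum_normc_le_rdot (u m - u n) [:: g] isT).
  rewrite big_seq1 normc_sqr uE real_normK ?num_real //.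
  by case: (u m g) => a b; case: (u n g) => c d /=; rewrite lerDl sqr_ge0.
have Ic g : cvgn (fun n => complex.Im (u n g)).
  apply: real_cauchy_cvg => e e0; have [N HN] := uC (e ^+ 2) (exprn_gt0 2 e0).
  exists N => m n Nm Nn; rewrite -(ltr_pXn2r (n := 2)) ?nnegrE ?(ltW e0) //.
  apply: le_lt_trans (HN m n Nm Nn).
  apply: le_trans (@sum_normc_le_rdot (u m - u n) [:: g] isT).
  rewrite big_seq1 normc_sqr uE real_normK ?num_real //.
  by case: (u m g) => a b; case: (u n g) => c d /=; rewrite lerDr sqr_ge0.
pose l g : R[i] := (limn (fun n => complex.Re (u n g)) +i*
                    limn (fun n => complex.Im (u n g)))%C.
have ul e : 0 < e -> exists N, forall n, (N <= n)%N ->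
    (sqsum (fun g => u n g - l g)%R <= e%:E)%E.
  move=> e0; have [N HN] := uC e e0; exists N => n Nn; apply: sqsum_le => s us.
  apply: (@cvgr_to_le _ \oo _ _
    (fun m => \sum_(g <- s) normc ((u n - u m) g) ^+ 2)).
    elim: s {us} => [|g s IH].
      by rewrite big_nil; under eq_fun do rewrite big_nil; exact: cvg_cst.
    rewrite big_cons; under eq_fun do rewrite big_cons.
    apply: cvgD IH; rewrite normc_sqr.
    have -> : complex.Re (u n g - l g) = complex.Re (u n g) - complex.Re (l g).
      by case: (u n g).
    have -> : complex.Im (u n g - l g) = complex.Im (u n g) - complex.Im (l g).
      by case: (u n g).
    have -> : (fun m => normc ((u n - u m) g) ^+ 2) =
      (fun m => (complex.Re (u n g) - complex.Re (u m g)) ^+ 2 +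
                (complex.Im (u n g) - complex.Im (u m g)) ^+ 2).
      apply/funext => m; rewrite normc_sqr uE.
      by case: (u n g) => a b; case: (u m g).
    rewrite !expr2; under eq_fun do rewrite !expr2.
    by apply: cvgD; apply: cvgM; apply: cvgB; try exact: cvg_cst;
      [exact: Rc|exact: Rc|exact: Ic|exact: Ic].
  exists N => // m Nm; apply: le_trans (sum_normc_le_rdot _ us) _.
  exact/ltW/HN.
have [N HN] := ul 1 ltr01.
have dl : (fun g => u N g - l g) \in @sqsummable R G.
  by rewrite /in_mem /= /sqsummable (le_lt_trans (HN N (leqnn N))) // ltry.
pose L : H := u N - Ell2 dl.
have LE g : L g = l g by rewrite -[L g]/(u N g - (u N g - l g)) subKr.
exists L => e e0; have [M HM] := ul (e / 2) (divr_gt0 e0 (ltr0Sn R 1)).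
exists M => n Mn; rewrite rdotxx -lte_fin fineK ?sqsum_fin_num //.
have -> : sqsum (u n - L) = sqsum (fun g => u n g - l g).
  by apply: eq_esum => g _; rewrite -LE.
apply: le_lt_trans (HM n Mn) _; rewrite lte_fin.
by rewrite ltr_pdivrMr // ltr_pMr // ltr1n.
Qed.

End Completeness.

(** * Hilbert modules and orthogonal projections *)

Section LinearMaps.
Variables (K : comNzRingType) (U V : lmodType K) (f : U -> V).
Hypothesis lf : linear f.

Lemma lin0 : f 0 = 0.
Proof. by have := lf (-1) 0 0; rewrite scaler0 add0r scaleN1r addNr. Qed.

Lemma linD x y : f (x + y) = f x + f y.
Proof. by have := lf 1 x y; rewrite !scale1r. Qed.

Lemma linZ c x : f (c *: x) = c *: f x.
Proof. by have := lf c x 0; rewrite !addr0 lin0 addr0. Qed.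

Lemma linB x y : f (x - y) = f x - f y.
Proof. by rewrite linD -scaleN1r linZ scaleN1r. Qed.
End LinearMaps.

(** A complex Hilbert space with a unitary action of [G], given by the real
part of its inner product. [ipZ] says that this real form comes from a
Hermitian one. *)
Record hilbert_module (R : realType) (G : groupType) := HilbertModule {
  hm_space :> lmodType R[i];
  ip : hm_space -> hm_space -> R;
  act : G -> hm_space -> hm_space;
  ipC : forall x y, ip x y = ip y x;
  ipDl : forall x y z, ip (x + y) z = ip x z + ip y z;
  ipZ : forall (c : R[i]) x y, ip (c *: x) y = ip x (conjc c *: y);
  ipZr : forall (r : R) x y, ip (r%:C%C *: x) y = r * ip x y;
  ip_ge0 : forall x, 0 <= ip x x;
  ip_eq0 : forall x, ip x x = 0 -> x = 0;
  ip_complete : forall u : nat -> hm_space,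
    (forall e : R, 0 < e -> exists N, forall m n, (N <= m)%N -> (N <= n)%N ->
      ip (u m - u n) (u m - u n) < e) ->
    exists l, forall e : R, 0 < e -> exists N, forall n, (N <= n)%N ->
      ip (u n - l) (u n - l) < e;
  act_linear : forall g, linear (act g);
  actK : forall g x, act g^-1%g (act g x) = x;
  act_unitary : forall g x y, ip (act g x) y = ip x (act g^-1%g y)
}.

Section HilbertModule.
Variables (R : realType) (G : groupType) (E : hilbert_module R G).
Implicit Types (x y z : E) (X Y : set E).
Local Notation ip := (@ip R G E).
Local Notation act := (@act R G E).
Local Notation nsq x := (ip x x).

Lemma ipDr x y z : ip x (y + z) = ip x y + ip x z.
Proof. by rewrite ipC ipDl !(ipC x). Qed.

Lemma ipNl x y : ip (- x) y = - ip x y.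
Proof.
have -> : - x = ((- 1 : R)%:C)%C *: x by rewrite rmorphN rmorph1 scaleN1r.
by rewrite ipZr mulN1r.
Qed.

Lemma ipNr x y : ip x (- y) = - ip x y.
Proof. by rewrite ipC ipNl ipC. Qed.

Lemma ipBl x y z : ip (x - y) z = ip x z - ip y z.
Proof. by rewrite ipDl ipNl. Qed.

Lemma ipBr x y z : ip x (y - z) = ip x y - ip x z.
Proof. by rewrite ipDr ipNr. Qed.

Lemma ip0l x : ip 0 x = 0.
Proof. by rewrite -(subrr x) ipBl subrr. Qed.

Lemma ip0r x : ip x 0 = 0.
Proof. by rewrite ipC ip0l. Qed.

Lemma ipZrr (r : R) x y : ip x (r%:C%C *: y) = r * ip x y.
Proof. by rewrite ipC ipZr ipC. Qed.

Lemma nsqZ (c : R[i]) x : nsq (c *: x) = normc c ^+ 2 * nsq x.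
Proof.
rewrite ipZ scalerA -ipZrr; congr (ip _ (_ *: _)).
rewrite normc_sqr; case: c => a b; apply/eqP; rewrite eq_complex /=.
by apply/andP; split; apply/eqP; ring.
Qed.

Lemma nsqB x y : nsq (x - y) = nsq x - 2 * ip x y + nsq y.
Proof. by rewrite !(ipBl, ipBr) (ipC y x); ring. Qed.

Lemma nsqD_le x y : nsq (x + y) <= 2 * nsq x + 2 * nsq y.
Proof.
have := ip_ge0 (x - y); rewrite nsqB !(ipDl, ipDr) (ipC y x); lra.
Qed.

Lemma nsqC x y : nsq (x - y) = nsq (y - x).
Proof. by rewrite !nsqB (ipC x y); ring. Qed.

Lemma cauchy_schwarz x y : ip x y ^+ 2 <= nsq x * nsq y.
Proof.
have [y0|y0] := eqVneq (nsq y) 0.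
  by rewrite (ip_eq0 y0) !ip0r expr0n mulr0.
have ypos : 0 < nsq y by rewrite lt_def y0 ip_ge0.
have := ip_ge0 (x - (ip x y / nsq y)%:C%C *: y).
rewrite nsqB !(ipZr, ipZrr).
have -> : nsq x - 2 * (ip x y / nsq y * ip x y) +
    ip x y / nsq y * (ip x y / nsq y * nsq y) =
    nsq x - ip x y ^+ 2 / nsq y by field; exact/eqP/eqP.
by rewrite subr_ge0 ler_pdivrMr.
Qed.

Lemma ip_ext x y : (forall z, ip x z = ip y z) -> x = y.
Proof.
move=> xy; apply/eqP; rewrite -subr_eq0; apply/eqP/ip_eq0.
by rewrite ipBl xy subrr.
Qed.

(** Closure for the norm of the inner product, so that it makes sense on a
direct sum of Hilbert modules before its topology is compared with this norm. *)
Definition adh X : set E :=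
  [set y | forall e : R, 0 < e -> exists x, X x /\ nsq (y - x) < e].

Definition submodule X := [/\ X 0,
  forall c x y, X x -> X y -> X (c *: x + y) & forall g x, X x -> X (act g x)].

Definition closed_submodule X := submodule X /\ adh X `<=` X.

Definition perp X : set E := [set x | forall y, X y -> ip x y = 0].

Lemma submodB X x y : submodule X -> X x -> X y -> X (x - y).
Proof.
by move=> [_ XD _] Xx Xy; rewrite -scaleN1r addrC; exact: XD.
Qed.

Lemma sub_adh X : X `<=` adh X.
Proof. by move=> x Xx e e0; exists x; rewrite subrr ip0l. Qed.

(** Take a minimizing sequence in [X] for the distance to [x]. The estimate
[key] shows at once that it is Cauchy and that its limit is orthogonal to
[X]. *)
Lemma projection_exists X x : closed_submodule X ->
  exists p, X p /\ forall y, X y -> ip (x - p) y = 0.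
Proof.
move=> [sX cX]; have [X0 XD _] := sX.
pose S := [set nsq (x - y) | y in X]; pose d := inf S.
have S0 : S !=set0 by exists (nsq (x - 0)), 0.
have lS : has_lbound S by exists 0 => _ [y _ <-]; exact: ip_ge0.
have dle y : X y -> d <= nsq (x - y) by move=> Xy; apply: ge_inf => //; exists y.
(* compare z with z + t y for the best t, namely <x - z, y> / |y|^2 *)
have key z y : X z -> X y -> ip (x - z) y ^+ 2 <= nsq y * (nsq (x - z) - d).
  move=> Xz Xy; have [y0|y0] := eqVneq (nsq y) 0.
    by rewrite (ip_eq0 y0) !ip0r expr0n mul0r.
  have ypos : 0 < nsq y by rewrite lt_def y0 ip_ge0.
  have := dle _ (XD (ip (x - z) y / nsq y)%:C%C y z Xy Xz).
  rewrite opprD addrA addrAC (nsqB (x - z)) !(ipZr, ipZrr).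
  have -> : nsq (x - z) - 2 * (ip (x - z) y / nsq y * ip (x - z) y) +
    ip (x - z) y / nsq y * (ip (x - z) y / nsq y * nsq y) =
    nsq (x - z) - ip (x - z) y ^+ 2 / nsq y by field; exact/eqP/eqP.
  by rewrite lerBrDr -lerBrDl ler_pdivrMr // mulrC.
have near_inf n : exists y, X y /\ nsq (x - y) < d + n.+1%:R^-1.
  have n0 : (0 : R) < n.+1%:R^-1 by rewrite invr_gt0.
  by have [_ [y Xy <-] lt] := inf_adherent n0 (conj S0 lS); exists y.
have [u uP] := choice near_inf.
have uX n : X (u n) by have [] := uP n.
have key_u n y : X y -> ip (x - u n) y ^+ 2 <= nsq y * n.+1%:R^-1.
  move=> Xy; apply: le_trans (key _ _ (uX n) Xy) _.
  rewrite ler_wpM2l ?ip_ge0 // lerBlDl; exact/ltW/(uP n).2.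
have arch (e : R) : 0 < e -> exists N, forall n, (N <= n)%N -> n.+1%:R^-1 < e.
  move=> e0; exists (Num.truncn e^-1) => n Nn.
  rewrite invf_plt ?posrE //; apply: lt_le_trans (truncnS_gt _) _.
  by rewrite ler_nat.
have [|l lP] := ip_complete (u := u).
  move=> e e0; have [N HN] := arch (e / 4) (divr_gt0 e0 (ltr0Sn R 3)).
  exists N => m n Nm Nn; set w := u m - u n.
  have Xw : X w by exact: submodB.
  have [w0|w0] := eqVneq (nsq w) 0; first by rewrite w0.
  have wpos : 0 < nsq w by rewrite lt_def w0 ip_ge0.
  have wE : nsq w = ip (x - u n) w - ip (x - u m) w.
    by rewrite -ipBl; congr (ip _ _); rewrite /w opprB [RHS]addrC addrA subrK.
  have := key_u m _ Xw; have := key_u n _ Xw.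
  have := HN m Nm; have := HN n Nn.
  have : nsq w * nsq w <= 2 * (ip (x - u n) w ^+ 2 + ip (x - u m) w ^+ 2).
    rewrite {1 2}wE; have := sqr_ge0 (ip (x - u n) w + ip (x - u m) w); nra.
  move: (ip (x - u n) w ^+ 2) (ip (x - u m) w ^+ 2) => A B h1 h2 h3 h4 h5.
  have {}h2 : nsq w * n.+1%:R^-1 < nsq w * (e / 4) by rewrite ltr_pM2l.
  have {}h3 : nsq w * m.+1%:R^-1 < nsq w * (e / 4) by rewrite ltr_pM2l.
  have : nsq w * nsq w < nsq w * e.
    move: (nsq w) h1 h4 h5 h2 h3 => W.
    by move: (n.+1%:R^-1) (m.+1%:R^-1) => p q h1 h4 h5 h2 h3; lra.
  by rewrite ltr_pM2l.
have Xl : X l.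
  apply: cX => e e0; have [N HN] := lP e e0; exists (u N).
  by rewrite nsqC; split; last exact: HN.
exists l; split=> // y Xy; apply/eqP; rewrite -sqrf_eq0 eq_le sqr_ge0 andbT.
apply/ler_addgt0Pr => e e0; rewrite add0r.
have k0 : 0 < 4 * (nsq y + 1) by have := ip_ge0 y; lra.
have [N1 H1] := arch _ (divr_gt0 e0 k0); have [N2 H2] := lP _ (divr_gt0 e0 k0).
have := key_u (maxn N1 N2) y Xy; have := H1 _ (leq_maxl N1 N2).
have := H2 _ (leq_maxr N1 N2); set n := maxn N1 N2.
have := cauchy_schwarz (u n - l) y.
have -> : ip (x - l) y = ip (x - u n) y + ip (u n - l) y.
  by rewrite -ipDl addrA subrK.
move: (ip (x - u n) y) (ip (u n - l) y) => A B h1.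
rewrite !ltr_pdivlMr // => h2 h3 h4.
have h5 := ip_ge0 y; have h6 := ip_ge0 (u n - l).
have h7 : (0 : R) < n.+1%:R^-1 by rewrite invr_gt0.
move: (n.+1%:R^-1) (nsq y) (nsq (u n - l)) h1 h2 h3 h4 h5 h6 h7.
move=> p Y D h1 h2 h3 h4 h5 h6 h7.
have := sqr_ge0 (A - B); nra.
Qed.

Lemma act_isometry g x : nsq (act g x) = nsq x.
Proof. by rewrite act_unitary actK. Qed.

End HilbertModule.

Section Projections.
Variables (R : realType) (G : groupType) (E : hilbert_module R G).
Implicit Types (x y z : E) (X Y : set E).
Local Notation nsq x := (ip x x).

Lemma submodule_adh X : submodule X -> closed_submodule (adh X).
Proof.
move=> sX; have [X0 XD Xa] := sX.
have half (e : R) : 0 < e -> 0 < e / 4 by lra.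
split.
  split; first exact: sub_adh.
    move=> c x y Xx Xy e e0.
    have k0 : 0 < normc c ^+ 2 + 1 by have := sqr_ge0 (normc c); lra.
    have [x' [Xx' lx]] := Xx _ (divr_gt0 (half _ e0) k0).
    have [y' [Xy' ly]] := Xy _ (half _ e0).
    exists (c *: x' + y'); split; first exact: XD.
    have -> : c *: x + y - (c *: x' + y') = c *: (x - x') + (y - y').
      by rewrite scalerBr opprD addrACA.
    apply: le_lt_trans (nsqD_le _ _) _.
    rewrite nsqZ.
    move: lx; rewrite ltr_pdivlMr //; have := ip_ge0 (x - x').
    by move: (nsq (x - x')) (nsq (y - y')) ly => a b; nra.
  move=> g x Xx e e0; have [x' [Xx' lx]] := Xx e e0.
  exists (act g x'); split; first exact: Xa.
  by rewrite -(linB (act_linear g)) act_isometry.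
move=> y Xy e e0; have [x [Xx lx]] := Xy _ (half _ e0).
have [x' [Xx' lx']] := Xx _ (half _ e0).
exists x'; split => //.
have -> : y - x' = (y - x) + (x - x') by rewrite addrA subrK.
by apply: le_lt_trans (nsqD_le _ _) _; lra.
Qed.

Lemma perp_closed X : submodule X -> closed_submodule (perp X).
Proof.
move=> [X0 XD Xa]; split.
  split => [y _|c x y Xx Xy z Xz|g x Xx z Xz]; first exact: ip0l.
    rewrite ipDl Xy // addr0 ipZ Xx // -(addr0 (_ *: z)); exact: XD.
  by rewrite act_unitary Xx //; exact: Xa.
move=> x Xx y Xy; apply/eqP; rewrite -sqrf_eq0 eq_le sqr_ge0 andbT.
apply/ler_addgt0Pr => e e0; rewrite add0r.
have k0 : 0 < nsq y + 1 by have := ip_ge0 y; lra.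
have [x' [Xx' lx]] := Xx _ (divr_gt0 e0 k0).
have := cauchy_schwarz (x - x') y; rewrite ipBl Xx' // subr0 => cs.
apply: (le_trans cs); move: lx; rewrite ltr_pdivlMr //.
by have := ip_ge0 (x - x'); have := ip_ge0 y; nra.
Qed.

Lemma perp_adh X x z : submodule X -> perp X z -> adh X x -> ip z x = 0.
Proof.
move=> sX pz Xx; have [_ cPP] := perp_closed (perp_closed sX).1.
rewrite ipC; apply: (cPP x) pz => e /Xx[y [Xy ye]]; exists y; split=> // w pw.
by rewrite ipC; exact: pw.
Qed.

Definition proj X x : E :=
  xget 0 [set p | X p /\ forall y, X y -> ip (x - p) y = 0].

Section OneProjection.
Variable X : set E.
Hypothesis cX : closed_submodule X.

Let sX : submodule X. Proof. by case: cX. Qed.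

Lemma projP x : X (proj X x) /\ forall y, X y -> ip (x - proj X x) y = 0.
Proof.
rewrite /proj; case: xgetP => [p _ //|no].
by have [p pP] := projection_exists x cX; case: (no p).
Qed.

Lemma proj_in x : X (proj X x). Proof. by case: (projP x). Qed.

Lemma proj_perp x : perp X (x - proj X x). Proof. by case: (projP x). Qed.

Lemma proj_unique x p : X p -> perp X (x - p) -> proj X x = p.
Proof.
move=> Xp xp; apply/eqP; rewrite -subr_eq0; apply/eqP/ip_eq0.
have Xd : X (proj X x - p) by apply: submodB => //; exact: proj_in.
have {1}-> : proj X x - p = (x - p) - (x - proj X x).
  by rewrite opprB [RHS]addrC addrA subrK.
by rewrite ipBl xp // proj_perp // subrr.
Qed.

Lemma proj_id x : X x -> proj X x = x.
Proof. by move=> Xx; apply: proj_unique => // y _; rewrite subrr ip0l. Qed.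

Lemma proj_eq0 x : perp X x -> proj X x = 0.
Proof. by move=> px; apply: proj_unique; rewrite ?subr0 //; case: sX. Qed.

Lemma proj_eq0P x : proj X x = 0 -> perp X x.
Proof. by move=> p0; rewrite -[x]subr0 -p0; exact: proj_perp. Qed.

Lemma proj_idem x : proj X (proj X x) = proj X x.
Proof. by rewrite proj_id //; exact: proj_in. Qed.

Lemma ip_proj x y : X y -> ip (proj X x) y = ip x y.
Proof.
by move=> Xy; apply/eqP; rewrite eq_sym -subr_eq0 -ipBl; apply/eqP/proj_perp.
Qed.

Lemma proj_selfadjoint x y : ip (proj X x) y = ip x (proj X y).
Proof.
by rewrite -(ip_proj x) ?(ipC _ (proj X y)) ?(ip_proj y) 1?ipC //; exact: proj_in.
Qed.

Lemma proj_linear : linear (proj X).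
Proof.
move=> c x y; apply: proj_unique.
  have [_ XD _] := sX; apply: XD; exact: proj_in.
have -> : c *: x + y - (c *: proj X x + proj X y) =
    c *: (x - proj X x) + (y - proj X y) by rewrite scalerBr opprD addrACA.
have [[_ pD _] _] := perp_closed sX; apply: pD; exact: proj_perp.
Qed.

Lemma proj_act g x : proj X (act g x) = act g (proj X x).
Proof.
have [_ _ Xa] := sX; apply: proj_unique; first by apply: Xa; exact: proj_in.
rewrite -(linB (act_linear g)).
have [[_ _ pa] _] := perp_closed sX; apply: pa; exact: proj_perp.
Qed.

Lemma nsq_proj x : nsq x = nsq (proj X x) + nsq (x - proj X x).
Proof.
have pE : ip x (proj X x) = nsq (proj X x).
  by rewrite proj_selfadjoint proj_idem.
by rewrite nsqB pE; ring.
Qed.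

Lemma proj_le x : nsq (proj X x) <= nsq x.
Proof. by rewrite (nsq_proj x) lerDl ip_ge0. Qed.

End OneProjection.

(** The difference of [x] and its projection onto the closure of [X] is
orthogonal to [X], hence to [x]; it is also orthogonal to the projection, so
it is 0. *)
Lemma perpK X x : submodule X -> perp (perp X) x -> adh X x.
Proof.
move=> sX px; have cX := submodule_adh sX; set p := proj (adh X) x.
have Xp : adh X p by exact: proj_in.
have pd : perp X (x - p).
  by move=> y Xy; apply: (proj_perp cX); exact: sub_adh.
have : nsq (x - p) = 0.
  by rewrite ipBr (ipC _ x) px // (proj_perp cX x Xp) subrr.
by move=> /ip_eq0/eqP; rewrite subr_eq0 => /eqP ->.
Qed.

End Projections.

(** * Adjointable equivariant operators *)

Section Intertwiners.
Variables (R : realType) (G : groupType).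
Implicit Types E F K : hilbert_module R G.

(** Operators are carried together with their adjoint, which is explicit for
all the operators used below. *)
Definition intertwiner E F (f : E -> F) (f' : F -> E) : Prop :=
  [/\ linear f, exists2 M : R, 0 <= M & forall x, ip (f x) (f x) <= M * ip x x,
      forall g x, f (act g x) = act g (f x) & forall x y, ip (f x) y = ip x (f' y)].

Lemma intertwiner_adjoint E F (f : E -> F) f' x y : intertwiner f f' ->
  ip (f' y) x = ip y (f x).
Proof. by case=> _ _ _ adj; rewrite ipC -adj ipC. Qed.

(** Cauchy-Schwarz applied to [<f (f' y), y>]. *)
Lemma adjoint_bound E F (f : E -> F) f' (M : R) : intertwiner f f' -> 0 <= M ->
  (forall x, ip (f x) (f x) <= M * ip x x) ->
  forall y, ip (f' y) (f' y) <= M * ip y y.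
Proof.
move=> ff M0 fM y; have [_ _ _ adj] := ff.
have [->|y0] := eqVneq (ip (f' y) (f' y)) 0; first by rewrite mulr_ge0 // ip_ge0.
have y1 : 0 < ip (f' y) (f' y) by rewrite lt_def y0 ip_ge0.
rewrite -(ler_pM2l y1) -expr2 -[X in X ^+ 2]adj.
apply: le_trans (cauchy_schwarz _ _) _; rewrite mulrA [_ * M]mulrC.
by rewrite ler_wpM2r // ip_ge0.
Qed.

Lemma intertwiner_sym E F (f : E -> F) f' : intertwiner f f' -> intertwiner f' f.
Proof.
move=> ff; have [lf [M M0 fM] fa adj] := ff; split.
- move=> c u v; apply: ip_ext => z; rewrite (intertwiner_adjoint _ _ ff).
  rewrite !ipDl !ipZ !(intertwiner_adjoint _ _ ff).
  by rewrite (linZ lf).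
- by exists M => //; exact: adjoint_bound ff M0 fM.
- move=> g x; apply: ip_ext => z; rewrite (intertwiner_adjoint _ _ ff).
  by rewrite !act_unitary (intertwiner_adjoint _ _ ff) fa.
- by move=> x y; rewrite (intertwiner_adjoint _ _ ff).
Qed.

Lemma intertwiner_id E : intertwiner (fun x : E => x) (fun x => x).
Proof. by split => //; exists 1 => // x; rewrite mul1r. Qed.

Lemma intertwiner_comp E F K (f : E -> F) f' (h : F -> K) h' :
  intertwiner f f' -> intertwiner h h' ->
  intertwiner (fun x => h (f x)) (fun y => f' (h' y)).
Proof.
move=> [lf [M M0 fM] fa fadj] [lh [N N0 hN] ha hadj]; split.
- by move=> c u v; rewrite lf lh.
- exists (N * M) => [|x]; first by rewrite mulr_ge0.
  by apply: le_trans (hN _) _; rewrite -mulrA ler_wpM2l.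
- by move=> g x; rewrite fa ha.
- by move=> x y; rewrite hadj fadj.
Qed.

Lemma intertwiner_add E F (f : E -> F) f' h h' :
  intertwiner f f' -> intertwiner h h' ->
  intertwiner (fun x => f x + h x) (fun x => f' x + h' x).
Proof.
move=> [lf [M M0 fM] fa fadj] [lh [N N0 hN] ha hadj]; split.
- by move=> c u v; rewrite lf lh scalerDr addrACA.
- exists (2 * M + 2 * N) => [|x]; first by lra.
  apply: le_trans (nsqD_le _ _) _; have := fM x; have := hN x; lra.
- by move=> g x; rewrite fa ha (linD (act_linear g)).
- by move=> x y; rewrite ipDl ipDr fadj hadj.
Qed.

Lemma intertwiner_scale E F (f : E -> F) f' (t : R) :
  intertwiner f f' ->
  intertwiner (fun x => t%:C%C *: f x) (fun x => t%:C%C *: f' x).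
Proof.
move=> [lf [M M0 fM] fa fadj]; split.
- by move=> c u v; rewrite lf scalerDr !scalerA mulrC.
- exists (t ^+ 2 * M) => [|x]; first by rewrite mulr_ge0 // sqr_ge0.
  rewrite ipZr ipZrr mulrA -expr2 -mulrA ler_wpM2l ?sqr_ge0 //.
- by move=> g x; rewrite fa (linZ (act_linear g)).
- by move=> x y; rewrite ipZr ipZrr fadj.
Qed.

Lemma intertwiner_sub E F (f : E -> F) f' h h' :
  intertwiner f f' -> intertwiner h h' ->
  intertwiner (fun x => f x - h x) (fun x => f' x - h' x).
Proof.
move=> ff /(intertwiner_scale (-1)) hh.
have N1 (V : lmodType R[i]) (x : V) : - x = ((- 1 : R)%:C)%C *: x.
  by rewrite rmorphN rmorph1 scaleN1r.
have -> : (fun x => f x - h x) = (fun x => f x + ((- 1 : R)%:C)%C *: h x).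
  by apply/funext => x; rewrite N1.
have -> : (fun x => f' x - h' x) = (fun x => f' x + ((- 1 : R)%:C)%C *: h' x).
  by apply/funext => x; rewrite N1.
exact: intertwiner_add.
Qed.

Lemma intertwiner_iter E (f : E -> E) f' n : intertwiner f f' ->
  intertwiner (iter n f) (iter n f').
Proof.
move=> ff; elim: n => [|n IH]; first exact: intertwiner_id.
have -> : iter n.+1 f' = fun x => iter n f' (f' x).
  by apply/funext => x; rewrite iterSr.
exact: intertwiner_comp IH ff.
Qed.

Lemma intertwiner_proj E (X : set E) : closed_submodule X ->
  intertwiner (proj X) (proj X).
Proof.
move=> cX; split.
- exact: proj_linear.
- by exists 1 => // x; rewrite mul1r; exact: proj_le.
- exact: proj_act.
- exact: proj_selfadjoint.
Qed.

Definition ker E F (f : E -> F) : set E := [set x | f x = 0].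

Lemma ker_perp_range E F (f : E -> F) f' : intertwiner f f' ->
  ker f = perp (range f').
Proof.
move=> ff; apply/seteqP; split => x; rewrite /ker /=.
  move=> fx _ [y _ <-]; have [_ _ _ <-] := ff; by rewrite fx ip0l.
move=> px; apply: ip_ext => y; have [_ _ _ ->] := ff.
by rewrite ip0l px.
Qed.

Lemma submodule_range E F (f : E -> F) f' : intertwiner f f' ->
  submodule (range f).
Proof.
move=> [lf _ fa _]; split.
- by exists 0 => //; exact: lin0.
- by move=> c _ _ [x _ <-] [y _ <-]; exists (c *: x + y) => //; rewrite lf.
- by move=> g _ [x _ <-]; exists (act g x) => //; rewrite fa.
Qed.

Lemma closed_ker E F (f : E -> F) f' : intertwiner f f' -> closed_submodule (ker f).
Proof.
move=> ff; rewrite (ker_perp_range ff); apply: perp_closed.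
exact: submodule_range (intertwiner_sym ff).
Qed.

End Intertwiners.

(** * Powers converging to the projection onto a kernel *)

Section Landweber.
Variables (R : realType) (G : groupType) (E F : hilbert_module R G).
Variables (W : E -> F) (W' : F -> E).
Hypothesis WW : intertwiner W W'.
Hypothesis W1 : forall x, ip (W x) (W x) <= ip x x.

(** The Landweber iteration for the equation [W x = 0]. *)
Definition landweber (x : E) : E := x - W' (W x).
Local Notation T := landweber.

Let S := fun x => W' (W x).
Let SS : intertwiner S S.
Proof. exact: intertwiner_comp WW (intertwiner_sym WW). Qed.

Lemma intertwiner_landweber : intertwiner T T.
Proof. exact: intertwiner_sub (intertwiner_id E) SS. Qed.

Let S_le x : ip (S x) (S x) <= ip (W x) (W x).
Proof.
rewrite -[leRHS]mul1r; apply: (adjoint_bound WW) => // y.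
by rewrite mul1r.
Qed.

Let T_le x : ip (T x) (T x) <= ip x x - ip (S x) (S x).
Proof.
have xS : ip x (S x) = ip (W x) (W x) by rewrite ipC (intertwiner_adjoint _ _ WW).
rewrite /landweber nsqB -/(S x) xS; have := S_le x; lra.
Qed.

Let iterT_le n x : ip (iter n T x) (iter n T x) <= ip x x.
Proof.
elim: n => //= n; apply: le_trans; apply: le_trans (T_le _) _.
by rewrite gerBl ip_ge0.
Qed.

Let iterT_S n x : iter n T (S x) = S (iter n T x).
Proof.
elim: n => //= n ->; have [lS _ _ _] := SS.
by rewrite /landweber -/(S _) (linB lS).
Qed.

Let sum_S n x :
  n.+1%:R * ip (S (iter n T x)) (S (iter n T x)) <=
  ip x x - ip (iter n.+1 T x) (iter n.+1 T x).
Proof.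
elim: n => [|n IH]; first by rewrite mul1r /=; have := T_le x; lra.
have dec : ip (S (iter n.+1 T x)) (S (iter n.+1 T x)) <=
    ip (S (iter n T x)) (S (iter n T x)).
  rewrite -!iterT_S /=; apply: le_trans (T_le _) _.
  by rewrite gerBl ip_ge0.
have := T_le (iter n.+1 T x); rewrite -[T (iter n.+1 T x)]/(iter n.+2 T x).
rewrite -[n.+2%:R]natr1 mulrDl mul1r.
have : n.+1%:R * ip (S (iter n.+1 T x)) (S (iter n.+1 T x)) <=
   n.+1%:R * ip (S (iter n T x)) (S (iter n T x)) by rewrite ler_wpM2l.
lra.
Qed.

Lemma ker_adjoint_comp : ker S = ker W.
Proof.
apply/seteqP; split => x; rewrite /ker /=; last first.
  by move=> Wx; rewrite /S Wx; have [/lin0 -> _ _ _] := intertwiner_sym WW.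
move=> Sx; apply: ip_eq0; rewrite -(intertwiner_adjoint _ _ WW).
by rewrite -/(S x) Sx ip0l.
Qed.

(** The kernel component of [x] is fixed by the iteration. The orthogonal
component is a limit of vectors [S z] with [S = W' W], and
[|T^n (S z)|^2 <= |T^n z|^2 - |T^n.+1 z|^2]; the left-hand sides decrease and
add up to at most [|z|^2], hence are at most [|z|^2 / (n + 1)]. *)
Lemma landweber_cvg x (e : R) : 0 < e -> exists N, forall n, (N <= n)%N ->
  ip (proj (ker W) x) (proj (ker W) x) <= ip (iter n T x) (iter n T x) <=
  ip (proj (ker W) x) (proj (ker W) x) + e.
Proof.
move=> e0; have cK := closed_ker WW.
set p := proj (ker W) x; pose y := x - p.
have Kp : W p = 0 by exact: (proj_in cK).
have Tp n : iter n T p = p.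
  elim: n => //= n ->; rewrite /landweber Kp.
  by have [/lin0 -> _ _ _] := intertwiner_sym WW; rewrite subr0.
have lTn n : linear (iter n T).
  by case: (intertwiner_iter n intertwiner_landweber).
have Tadj n u v : ip (iter n T u) v = ip u (iter n T v).
  by case: (intertwiner_iter n intertwiner_landweber).
have xE n : iter n T x = p + iter n T y.
  by rewrite -{1}(Tp n) -(linD (lTn n)) /y addrC subrK.
have nsqE n : ip (iter n T x) (iter n T x) = ip p p + ip (iter n T y) (iter n T y).
  rewrite xE !(ipDl, ipDr) (ipC _ p) -Tadj Tp.
  have -> : ip p y = 0 by rewrite ipC; exact: (proj_perp cK).
  ring.
have yS : adh (range S) y.
  apply: perpK; first exact: submodule_range SS.
  by rewrite -(ker_perp_range SS) ker_adjoint_comp; exact: proj_perp.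
have e4 : 0 < e / 4 by lra.
have [_ [[z _ <-] yz]] := yS _ e4.
exists (Num.truncn (ip z z * 4 / e)) => n Nn; rewrite nsqE lerDl ip_ge0 lerD2l /=.
have -> : y = (y - S z) + S z by rewrite subrK.
rewrite (linD (lTn n)) iterT_S; apply: le_trans (nsqD_le _ _) _.
have h1 := iterT_le n (y - S z); have h2 := sum_S n z.
have h3 := ip_ge0 (iter n.+1 T z); have h4 := ip_ge0 (S (iter n T z)).
have n0 : (0 : R) < n.+1%:R by [].
have h5 : ip z z * 4 / e < n.+1%:R.
  by apply: lt_le_trans (truncnS_gt _) _; rewrite ler_nat.
move: h5; rewrite ltr_pdivrMr // => h5.
suff : ip (S (iter n T z)) (S (iter n T z)) <= e / 4 by lra.
rewrite -(ler_pM2l n0).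
move: (n.+1%:R) h2 h5 n0 => k h2 h5 n0; lra.
Qed.

End Landweber.

(** * Traces and von Neumann dimension *)

Section Trace.
Variables (R : realType) (G : groupType) (E : hilbert_module R G).
Implicit Types (f h : E -> E) (X Y : set E).

Definition trace (d : seq E) f : R := \sum_(v <- d) ip (f v) v.

(** A finite trace on the operators of [E], given by vector states; the
separating property makes it faithful. *)
Record tracial (d : seq E) : Prop := Tracial {
  trace_cyclic : forall f f' h h', intertwiner f f' -> intertwiner h h' ->
    trace d (fun x => f (h x)) = trace d (fun x => h (f x));
  trace_separating : forall f f', intertwiner f f' ->
    (forall v, v \in d -> f v = 0) -> forall x, f x = 0 }.

Variable d : seq E.
Hypothesis td : tracial d.

Definition vN_dim X : R := trace d (proj X).

Lemma traceB f h : trace d (fun x => f x - h x) = trace d f - trace d h.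
Proof. by rewrite /trace -sumrB; apply: eq_bigr => v _; rewrite ipBl. Qed.

(** The difference of the two projections is a projection of trace zero. *)
Lemma vN_dim_inj X Y : closed_submodule X -> closed_submodule Y -> X `<=` Y ->
  vN_dim X = vN_dim Y -> Y `<=` X.
Proof.
move=> cX cY XY dXY.
pose f x := proj Y x - proj X x.
have ff := intertwiner_sub (intertwiner_proj cY) (intertwiner_proj cX).
(* f is a projection since X is contained in Y *)
have fE v : ip (f v) v = ip (f v) (f v).
  have q Z : closed_submodule Z -> ip (proj Z v) (proj Z v) = ip (proj Z v) v.
    by move=> cZ; rewrite [LHS]proj_selfadjoint // proj_idem // ipC.
  have YX : ip (proj Y v) (proj X v) = ip (proj X v) v.
    by rewrite ip_proj 1?ipC //; apply: XY; exact: proj_in.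
  by rewrite /f ipBl nsqB !q // YX; ring.
have tf : trace d f = 0 by rewrite traceB -/(vN_dim Y) -/(vN_dim X) dXY subrr.
have f0 x : f x = 0.
  apply: (trace_separating td ff) => v vd; apply: ip_eq0; rewrite -fE.
  move/eqP: tf; rewrite /trace psumr_eq0; last by move=> w _; rewrite fE ip_ge0.
  by move=> /allP /(_ v vd)/eqP.
move=> y Yy; have := f0 y; rewrite /f (proj_id cY) // => /eqP.
by rewrite subr_eq0 => /eqP ->; exact: proj_in.
Qed.

End Trace.

Section DimensionKernel.
Variables (R : realType) (G : groupType) (E : hilbert_module R G) (d : seq E).
Hypothesis td : tracial d.

(** [W'] carries the iteration for [W'] to that for [W]; cyclicity of the
trace does the rest. *)
Lemma trace_landweber (W W' : E -> E) n : intertwiner W W' ->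
  trace d (iter n (landweber W W')) = trace d (iter n (landweber W' W)).
Proof.
move=> WW; have WW' := intertwiner_sym WW.
elim: n => //= n IH.
have WT m x : W' (iter m (landweber W' W) x) = iter m (landweber W W') (W' x).
  elim: m => //= m <-; rewrite /landweber.
  by have [lW' _ _ _] := WW'; rewrite (linB lW').
rewrite /landweber !traceB -!/(landweber _ _) IH; congr (_ - _).
have := trace_cyclic td (intertwiner_comp
  (intertwiner_iter n (intertwiner_landweber WW)) WW) WW'.
by move=> <-; congr trace; apply/funext => x; rewrite WT.
Qed.

(** Even powers are used because [T] is self-adjoint, so that
[<T^(2n) v, v> = |T^n v|^2]. *)
Lemma trace_landweber_cvg (W W' : E -> E) (e : R) : intertwiner W W' ->
  (forall x, ip (W x) (W x) <= ip x x) -> 0 < e ->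
  exists N, forall n, (N <= n)%N ->
    vN_dim d (ker W) <= trace d (iter (n + n) (landweber W W')) <=
    vN_dim d (ker W) + (size d)%:R * e.
Proof.
move=> WW W1 e0; rewrite /vN_dim /trace; have cK := closed_ker WW.
have TT n u v : ip (iter n (landweber W W') u) v = ip u (iter n (landweber W W') v).
  by case: (intertwiner_iter n (intertwiner_landweber WW)).
elim: d => [|v s [N HN]].
  by exists 0 => n _; rewrite !big_nil mul0r addr0 lexx.
have [M HM] := landweber_cvg WW W1 v e0; exists (maxn N M) => n.
rewrite geq_max => /andP[/HN Nn /HM Mn]; rewrite !big_cons [size _]/=.
rewrite iterD TT -natr1 mulrDl mul1r.
have -> : ip (proj (ker W) v) v = ip (proj (ker W) v) (proj (ker W) v).
  by rewrite [RHS]proj_selfadjoint // proj_idem // ipC.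
lra.
Qed.

(** Both dimensions are limits of the same sequence of traces. *)
Lemma vN_dim_ker_adjoint_contraction (W W' : E -> E) : intertwiner W W' ->
  (forall x, ip (W x) (W x) <= ip x x) -> vN_dim d (ker W) <= vN_dim d (ker W').
Proof.
move=> WW W1; have WW' := intertwiner_sym WW.
have W'1 y : ip (W' y) (W' y) <= ip y y.
  by rewrite -[leRHS]mul1r; apply: (adjoint_bound WW) => // x; rewrite mul1r.
apply/ler_addgt0Pr => e e0; pose k : R := (size d)%:R + 1.
have k0 : 0 < k by rewrite ltr_wpDl.
have [N HN] := trace_landweber_cvg WW W1 (divr_gt0 e0 k0).
have [M HM] := trace_landweber_cvg WW' W'1 (divr_gt0 e0 k0).
have /andP[h1 _] := HN _ (leq_maxl N M); have /andP[_ h2] := HM _ (leq_maxr N M).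
rewrite (le_trans h1) // trace_landweber // (le_trans h2) // lerD2l.
rewrite mulrA ler_pdivrMr // mulrC ler_wpM2l ?(ltW e0) //.
by rewrite lerDl.
Qed.

Lemma ker_scale (f : E -> E) (t : R) : t != 0 ->
  ker (fun x => t%:C%C *: f x) = ker f.
Proof.
move=> t0; apply/seteqP; split => x; rewrite /ker /=; last first.
  by move=> ->; rewrite scaler0.
by move/eqP; rewrite scaler_eq0 fmorph_eq0 (negPf t0) => /eqP.
Qed.

(** The rank-nullity theorem, in the form that rows and columns have the
same rank. *)
Lemma vN_dim_ker_adjoint (W W' : E -> E) : intertwiner W W' ->
  vN_dim d (ker W) = vN_dim d (ker W').
Proof.
suff le (V V' : E -> E) : intertwiner V V' -> vN_dim d (ker V) <= vN_dim d (ker V').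
  move=> WW; apply/eqP; rewrite eq_le !le //; exact: intertwiner_sym.
move=> VV; have [_ [M M0 VM] _ _] := VV.
have k0 : 0 < M + 1 by lra.
have t0 : (M + 1)^-1 != 0 by rewrite invr_neq0 // gt_eqF.
rewrite -(ker_scale V t0) -(ker_scale V' t0).
apply: vN_dim_ker_adjoint_contraction; first exact: intertwiner_scale.
move=> x; rewrite ipZr ipZrr mulrA -invfM mulrC ler_pdivrMr ?mulr_gt0 //.
by apply: le_trans (VM x) _; have := ip_ge0 x; nra.
Qed.

End DimensionKernel.

(** * Direct sums *)

Section ProductModule.
Variables (R : realType) (G : groupType) (E F : hilbert_module R G).

Definition ip_prod (p q : E * F) : R := ip p.1 q.1 + ip p.2 q.2.
Definition act_prod g (p : E * F) : E * F := (act g p.1, act g p.2).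

Lemma ip_prod_complete (u : nat -> E * F) :
  (forall e : R, 0 < e -> exists N, forall m n, (N <= m)%N -> (N <= n)%N ->
    ip_prod (u m - u n) (u m - u n) < e) ->
  exists l, forall e : R, 0 < e -> exists N, forall n, (N <= n)%N ->
    ip_prod (u n - l) (u n - l) < e.
Proof.
move=> uC.
have [|l1 H1] := @ip_complete _ _ E (fun n => (u n).1).
  move=> e e0; have [N HN] := uC e e0; exists N => m n Nm Nn.
  by apply: le_lt_trans (HN m n Nm Nn); rewrite /ip_prod /= lerDl ip_ge0.
have [|l2 H2] := @ip_complete _ _ F (fun n => (u n).2).
  move=> e e0; have [N HN] := uC e e0; exists N => m n Nm Nn.
  by apply: le_lt_trans (HN m n Nm Nn); rewrite /ip_prod /= lerDr ip_ge0.
exists (l1, l2) => e e0; have e2 : 0 < e / 2 by lra.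
have [N HN] := H1 _ e2; have [M HM] := H2 _ e2.
exists (maxn N M) => n; rewrite geq_max => /andP[/HN h1 /HM h2].
rewrite /ip_prod /=; lra.
Qed.

Definition prod_module : hilbert_module R G.
Proof.
apply: (@HilbertModule R G (E * F)%type ip_prod act_prod).
- by move=> x y; rewrite /ip_prod ipC [X in _ + X]ipC.
- by move=> x y z; rewrite /ip_prod !ipDl addrACA.
- by move=> c x y; rewrite /ip_prod !ipZ.
- by move=> r x y; rewrite /ip_prod !ipZr mulrDr.
- by move=> x; rewrite addr_ge0 // ip_ge0.
- move=> [x y] /eqP; rewrite /ip_prod paddr_eq0 ?ip_ge0 //.
  by move=> /andP[/eqP/ip_eq0 /= -> /eqP/ip_eq0 /= ->].
- exact: ip_prod_complete.
- by move=> g c x y; rewrite /act_prod /= !(act_linear g).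
- by move=> g [x y]; rewrite /act_prod /= !actK.
- by move=> g x y; rewrite /ip_prod /= !act_unitary.
Defined.

End ProductModule.

(** * Fractions of operators *)

Section AdherenceMaps.
Variables (R : realType) (G : groupType).
Implicit Types E F K : hilbert_module R G.

Lemma adh_image E F (f : E -> F) f' (X : set E) y : intertwiner f f' ->
  adh X y -> adh (f @` X) (f y).
Proof.
move=> [lf [M M0 fM] _ _] Xy e e0; have k0 : 0 < M + 1 by lra.
have [x [Xx lx]] := Xy _ (divr_gt0 e0 k0).
exists (f x); split; first by exists x.
rewrite -(linB lf); apply: le_lt_trans (fM _) _.
by move: lx; rewrite ltr_pdivlMr //; have := ip_ge0 (y - x); nra.
Qed.

Lemma adh_idem E (X : set E) : submodule X -> adh (adh X) `<=` adh X.
Proof. by move=> /submodule_adh[]. Qed.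

Lemma adhS E (X Y : set E) : X `<=` Y -> adh X `<=` adh Y.
Proof. by move=> XY y Xy e /Xy[x [/XY Yx xe]]; exists x. Qed.

Lemma adh_range_comp E F K (f : F -> K) f' (D : E -> F) D' :
  intertwiner f f' -> intertwiner D D' -> (forall y, adh (range D) y) ->
  adh (range f) `<=` adh (range (fun x => f (D x))).
Proof.
move=> ff DD dD z fz.
apply: adh_idem; first exact: submodule_range (intertwiner_comp DD ff).
apply: adhS fz => _ [y _ <-].
apply: adhS (adh_image ff (dD y)) => _ [_ [x _ <-] <-].
by exists x.
Qed.

Lemma dense_range E F (f : E -> F) f' : intertwiner f f' ->
  (forall y, f' y = 0 -> y = 0) -> forall y, adh (range f) y.
Proof.
move=> ff inj y; apply: perpK; first exact: submodule_range ff.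
move=> z; rewrite -(ker_perp_range (intertwiner_sym ff)) => /inj ->.
exact: ip0r.
Qed.

Lemma dense_range_inj E F (f : E -> F) f' y : intertwiner f f' ->
  (forall y, adh (range f) y) -> f' y = 0 -> y = 0.
Proof.
move=> ff df f'y; apply: ip_eq0.
apply: perp_adh (submodule_range ff) _ (df y).
by rewrite -(ker_perp_range (intertwiner_sym ff)).
Qed.

End AdherenceMaps.

Section Fractions.
Variables (R : realType) (G : groupType) (H : hilbert_module R G).
Local Notation HH := (prod_module H H).

Definition inj1 (x : H) : HH := (x, 0).
Definition inj2 (x : H) : HH := (0, x).
Definition proj1 (p : HH) : H := p.1.
Definition proj2 (p : HH) : H := p.2.

Lemma intertwiner_inj1 : intertwiner inj1 proj1.
Proof.
split.
- by move=> c x y; apply: injective_projections; rewrite //= scaler0 addr0.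
- by exists 1 => // x; rewrite mul1r /= /ip_prod /= ip0l addr0.
- by move=> g x; congr (_, _); rewrite (lin0 (act_linear g)).
- by move=> x y; rewrite /= /ip_prod /= ip0l addr0.
Qed.

Lemma intertwiner_inj2 : intertwiner inj2 proj2.
Proof.
split.
- by move=> c x y; apply: injective_projections; rewrite //= scaler0 addr0.
- by exists 1 => // x; rewrite mul1r /= /ip_prod /= ip0l add0r.
- by move=> g x; congr (_, _); rewrite (lin0 (act_linear g)).
- by move=> x y; rewrite /= /ip_prod /= ip0l add0r.
Qed.

Definition pairing (A C : H -> H) (z : H) : HH := (A z, C z).
Definition copairing (A C : H -> H) (p : HH) : H := A p.1 + C p.2.

Lemma intertwiner_pairing (A A' C C' : H -> H) :
  intertwiner A A' -> intertwiner C C' ->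
  intertwiner (pairing A C) (copairing A' C').
Proof.
move=> AA CC.
have := intertwiner_add (intertwiner_comp AA intertwiner_inj1)
  (intertwiner_comp CC intertwiner_inj2).
suff -> : pairing A C = fun x => inj1 (A x) + inj2 (C x) by [].
by apply/funext => x; apply: injective_projections; rewrite /= ?addr0 ?add0r.
Qed.

Variable d : seq HH.
Hypothesis td : tracial d.

(** For operators of a finite von Neumann algebra dense range implies
injectivity: the adjoint of [A] is injective, and the kernels of [A] and its
adjoint have the same dimension. *)
Lemma dense_range_ker (A A' : H -> H) z : intertwiner A A' ->
  (forall y, adh (range A) y) -> A z = 0 -> z = 0.
Proof.
move=> AA dA Az.
have UU := intertwiner_comp (intertwiner_comp (intertwiner_sym intertwiner_inj1) AA)
  intertwiner_inj1.
have inj y : A' y = 0 -> y = 0 := dense_range_inj AA dA.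
have dk := vN_dim_ker_adjoint td UU.
have [A'0 _ _ _] := intertwiner_sym AA.
have sub : ker (fun p : HH => inj1 (A' (proj1 p))) `<=`
    ker (fun p : HH => inj1 (A (proj1 p))).
  move=> p; rewrite /ker /= => -[/inj p0].
  by rewrite p0; have [/lin0 -> _ _ _] := AA.
have Uz : ker (fun p : HH => inj1 (A (proj1 p))) (z, 0) by rewrite /ker /= Az.
have := vN_dim_inj td (closed_ker (intertwiner_sym UU)) (closed_ker UU) sub
  (esym dk) Uz.
by case=> /inj.
Qed.

(** Let [M] be the closure of the pairs [(A z, C z)]. The vectors of the form
[(0, y)] in [M] and the orthogonal complement of [M] all lie in the kernel of
[V], the first coordinate of the projection onto [M]. Passing to adjoints
three times, the kernel of [V] has the same dimension as the complement of [M],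
hence equals it; so [(0, y)] is orthogonal to itself. *)
Lemma fraction_single_valued (A A' C C' : H -> H) y :
  intertwiner A A' -> intertwiner C C' -> (forall z, A z = 0 -> C z = 0) ->
  adh (range (pairing A C)) (inj2 y) -> y = 0.
Proof.
move=> AA CC AC My.
have pAC := intertwiner_pairing AA CC.
have I1 := intertwiner_inj1; have I1' := intertwiner_sym I1.
pose M := adh (range (pairing A C)).
have sM := submodule_range pAC; have cM : closed_submodule M := submodule_adh sM.
(* operators on the sum H + H: W = (A, C), U = (A, 0), both of the first variable *)
have WW : intertwiner (fun p : HH => pairing A C (proj1 p))
    (fun q => inj1 (copairing A' C' q)) := intertwiner_comp I1' pAC.
have UU : intertwiner (fun p : HH => inj1 (A (proj1 p)))
    (fun q => inj1 (A' (proj1 q))) := intertwiner_comp (intertwiner_comp I1' AA) I1.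
have VV : intertwiner (fun p : HH => inj1 (proj1 (proj M p)))
    (fun q => proj M (inj1 (proj1 q))).
  exact: intertwiner_comp (intertwiner_comp (intertwiner_proj cM) I1') I1.
have perpM p : perp M p <-> copairing A' C' p = 0.
  rewrite -[copairing A' C' p = 0]/(ker (copairing A' C') p).
  rewrite (ker_perp_range (intertwiner_sym pAC)); split => pp q Mq.
    by apply: pp; exact: sub_adh.
  exact: perp_adh sM pp Mq.
have kWU : ker (fun p : HH => pairing A C (proj1 p)) =
    ker (fun p : HH => inj1 (A (proj1 p))).
  apply/seteqP; split => p; rewrite /ker /=; first by case=> -> _.
  by case=> Ap; rewrite /pairing Ap AC.
have kVU : ker (fun q : HH => proj M (inj1 (proj1 q))) =
    ker (fun q : HH => inj1 (A' (proj1 q))).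
  have [/lin0 C0 _ _ _] := intertwiner_sym CC.
  apply/seteqP; split => p; rewrite /ker /=.
    by move=> /(proj_eq0P cM)/perpM; rewrite /copairing /= C0 addr0 => ->.
  case=> Ap; apply: (proj_eq0 cM); apply/perpM.
  by rewrite /copairing /= C0 addr0.
have kWV : ker (fun q : HH => inj1 (copairing A' C' q)) `<=`
    ker (fun p : HH => inj1 (proj1 (proj M p))).
  move=> p; rewrite /ker /= => -[/perpM pM].
  by rewrite (proj_eq0 cM).
have Vy : ker (fun p : HH => inj1 (proj1 (proj M p))) (inj2 y).
  by rewrite /ker /= (proj_id cM).
have dims : vN_dim d (ker (fun q : HH => inj1 (copairing A' C' q))) =
    vN_dim d (ker (fun p : HH => inj1 (proj1 (proj M p)))).
  by rewrite -(vN_dim_ker_adjoint td WW) kWU (vN_dim_ker_adjoint td UU) -kVU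
    -(vN_dim_ker_adjoint td VV).
have := vN_dim_inj td (closed_ker (intertwiner_sym WW)) (closed_ker VV) kWV
  dims Vy.
case=> /perpM /(_ _ My) y0; apply: ip_eq0.
by move: y0; rewrite /= /ip_prod /= ip0l add0r.
Qed.

(** Let [Z] be the space of pairs [(v, u)] with [b v = e (B u)] and take for
[C] and [D] the two coordinates of the projection onto [Z] of [(0, z)]. If
[D u = 0] then [(0, u)] is orthogonal to [Z], hence lies in the closure of the
pairs [(b' s, - B' (e s))]; these form a fraction because [ker b'] is the
kernel of [e], so [u = 0]. As [D] is self-adjoint, its range is dense. *)
Lemma ore_condition (B B' b b' : H -> H) : intertwiner B B' -> intertwiner b b' ->
  let e := proj (adh (range b)) in
  exists D C C', [/\ intertwiner D D, intertwiner C C',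
    forall x, adh (range D) x & forall z, e (B (D z)) = b (C z)].
Proof.
move=> BB bb e; have sb := submodule_range bb; have cb := submodule_adh sb.
have ee : intertwiner e e := intertwiner_proj cb.
have eB := intertwiner_comp BB ee.
have NN : intertwiner (fun x : H => ((-1 : R)%:C)%C *: B' (e x))
    (fun x => ((-1 : R)%:C)%C *: e (B x)).
  exact: intertwiner_scale (intertwiner_sym eB).
have WW := intertwiner_sym (intertwiner_pairing (intertwiner_sym bb) NN).
set W := copairing _ _ in WW; set W' := pairing _ _ in WW.
have cZ := closed_ker WW; set Z := ker W in cZ.
have PP := intertwiner_proj cZ.
have I2 := intertwiner_inj2; have I2' := intertwiner_sym I2.
have I1' := intertwiner_sym intertwiner_inj1.
pose D x := proj2 (proj Z (inj2 x)).
have DD : intertwiner D D := intertwiner_comp (intertwiner_comp I2 PP) I2'.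
pose C x := proj1 (proj Z (inj2 x)).
have CC : intertwiner C (fun x => proj2 (proj Z (inj1 x))).
  exact: intertwiner_comp (intertwiner_comp I2 PP) I1'.
exists D, C, (fun x => proj2 (proj Z (inj1 x))); split => //.
  apply: dense_range DD _ => u Du.
  have P0 : proj Z (inj2 u) = 0.
    apply: ip_eq0; rewrite proj_selfadjoint // proj_idem //.
    by rewrite -[LHS]/(ip 0 _ + ip u (D u)) Du ip0l ip0r addr0.
  apply: (fraction_single_valued (intertwiner_sym bb) NN).
    have [/lin0 B'0 _ _ _] := intertwiner_sym BB.
    move=> z b'z; rewrite (_ : e z = 0) ?B'0 ?scaler0 //.
    apply: (proj_eq0 cb) => y by_; apply: perp_adh sb _ by_.
    by rewrite -(ker_perp_range (intertwiner_sym bb)).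
  apply: perpK; first exact: submodule_range (intertwiner_sym WW).
  by rewrite -(ker_perp_range WW); exact: (proj_eq0P cZ).
move=> z; have : W (proj Z (inj2 z)) = 0 by exact: (proj_in cZ).
rewrite /W /copairing -/(C z) -/(D z) rmorphN rmorph1 scaleN1r => /eqP.
by rewrite subr_eq0 => /eqP <-.
Qed.

(** Take for [A] and [B] the coordinates of the projection onto [T] of
[(z, 0)]; for the graph of an operator [t] they are [(1 + t* t)^-1] and
[t (1 + t* t)^-1]. A vector of [T] orthogonal to all these projections has
first coordinate 0, hence vanishes. *)
Lemma graph_fraction (T : set HH) : closed_submodule T ->
  (forall y, T (inj2 y) -> y = 0) ->
  (forall x, adh [set x | exists y, T (x, y)] x) ->
  exists A B B', [/\ intertwiner A A, intertwiner B B',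
    forall x, adh (range A) x & T = adh (range (pairing A B))].
Proof.
move=> cT sT dT; have PP := intertwiner_proj cT.
have I1 := intertwiner_inj1; have I1' := intertwiner_sym I1.
have I2' := intertwiner_sym intertwiner_inj2.
pose A x := proj1 (proj T (inj1 x)); pose B x := proj2 (proj T (inj1 x)).
have AA : intertwiner A A := intertwiner_comp (intertwiner_comp I1 PP) I1'.
have BB : intertwiner B (fun x => proj1 (proj T (inj2 x))).
  exact: intertwiner_comp (intertwiner_comp I1 PP) I2'.
have pE z : pairing A B z = proj T (inj1 z) by rewrite [RHS]surjective_pairing.
exists A, B, (fun x => proj1 (proj T (inj2 x))); split => //.
  apply: dense_range AA _ => u Au.
  have P0 : proj T (inj1 u) = 0.
    apply: ip_eq0; rewrite proj_selfadjoint // proj_idem //.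
    by rewrite -[LHS]/(ip u (A u) + ip 0 _) Au ip0l ip0r addr0.
  apply: ip_eq0.
  have sd : submodule [set x | exists y, T (x, y)].
    have [[T0 TD Ta] _] := cT; split; first by exists 0.
      move=> c x y [x' Tx] [y' Ty]; exists (c *: x' + y').
      exact: (TD c _ _ Tx Ty).
    by move=> g x [y Txy]; exists (act g y); exact: (Ta g _ Txy).
  apply: perp_adh sd _ (dT u).
  move=> x [y Txy]; have := proj_eq0P cT P0 Txy.
  by rewrite /= /ip_prod /= ip0l addr0.
apply/seteqP; split => p.
  move=> Tp; apply: perpK; first exact: submodule_range (intertwiner_pairing AA BB).
  move=> q pq.
  have P1 : proj1 (proj T q) = 0.
    apply: ip_ext => z; rewrite ip0l.
    have := pq (pairing A B z) (ex_intro2 _ _ z I erefl).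
    by rewrite pE -proj_selfadjoint //= /ip_prod /= ip0r addr0.
  have Pq : proj T q = 0.
    have := proj_in cT q; rewrite [proj T q]surjective_pairing -/(proj1 _) P1.
    by move=> /sT ->.
  by rewrite -(proj_id cT Tp) proj_selfadjoint // Pq ip0r.
move=> Mp; case: (cT) => _; apply; apply: adhS Mp => _ [z _ <-].
by rewrite pE; exact: proj_in.
Qed.

End Fractions.

(** * The trace of matrices over the group von Neumann algebra *)

Section Ell2Module.
Variables (R : realType) (G : groupType).
Local Notation H := (ell2 R G).
Local Notation delta g := (ell2_basis R g).

Lemma rtrans_linear (g : G) : linear (@rtrans R G g).
Proof. by move=> c x y; apply/val_inj/funext. Qed.

Lemma rtransK (g : G) (x : H) : rtrans g^-1%g (rtrans g x) = x.
Proof.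
apply/val_inj/funext => h /=.
by rewrite invgK -mulgA mulgV mulg1.
Qed.

Definition ell2_module : hilbert_module R G :=
  @HilbertModule R G H (@rdot R G) (@rtrans R G) (@rdotC R G) (@rdotDl R G)
    (@rdotZ R G) (@rdotZr R G) (@rdot_ge0 R G) (@rdot_eq0 R G)
    (@rdot_complete R G) rtrans_linear rtransK (@rtrans_unitary R G).
Local Notation HM := ell2_module.
Local Notation HH := (prod_module HM HM).
Local Notation delta1 := (inj1 (H := HM) (delta 1%g)).
Local Notation delta2 := (inj2 (H := HM) (delta 1%g)).

Lemma rtrans_basis (g : G) : rtrans g (delta 1%g) = delta g.
Proof.
apply/val_inj/funext => h /=; congr (_%:R); congr nat_of_bool.
apply/eqP/eqP => [h1|->]; last by rewrite mulgV.
by apply: (mulIg g^-1%g); rewrite h1 mulgV.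
Qed.

Lemma cdot_inj (z w : R[i]) : (forall c, cdot z c = cdot w c) -> z = w.
Proof.
move=> zw; have := zw 1; have := zw 'i%C; rewrite !cdotE.
case: z w {zw} => [a b] [c d] /=; rewrite !mulr0 !mulr1 !add0r !addr0.
by move=> -> ->.
Qed.

Lemma cdot0 (z : R[i]) : (forall c, cdot z c = 0) -> z = 0.
Proof. by move=> z0; apply: cdot_inj => c; rewrite z0 cdotE /= !mul0r addr0. Qed.

(** The pairing of [f' delta] with [c delta_g] is that of [delta] with
[c f delta_g], and [f delta_g] is a translate of [f delta]. *)
Lemma adjoint_basis (f f' : HM -> HM) g : @intertwiner R G HM HM f f' ->
  (f' (delta 1%g) : H) g = conjc ((f (delta 1%g) : H) g^-1%g).
Proof.
move=> ff; have [lf _ fa _] := ff; apply: cdot_inj => c.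
rewrite -rdot_basis -[rdot _ _]/(ip (f' (delta 1%g)) _).
rewrite (intertwiner_adjoint _ _ ff) (linZ lf) -(rtrans_basis g).
rewrite (fa g) ipC -[X in ip _ X]scale1r -[LHS]/(rdot _ _) rdot_basis.
rewrite -[LHS]/(cdot (c * (f (delta 1%g) : H) (1 * g^-1)%g) 1) mul1g.
rewrite !cdotE; case: c => a b; case: (_ (g^-1)%g) => a' b' /=; ring.
Qed.

(** Both sides are the real part of the sum over [g] of
[(f delta)_(g^-1) (h delta)_g], which is symmetric under inversion. *)
Lemma trace_cyclic_ell2 (f f' h h' : HM -> HM) :
  @intertwiner R G HM HM f f' -> @intertwiner R G HM HM h h' ->
  rdot (f (h (delta 1%g))) (delta 1%g) = rdot (h (f (delta 1%g))) (delta 1%g).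
Proof.
move=> ff hh.
have E (u u' v : HM -> HM) : @intertwiner R G HM HM u u' ->
    rdot (u (v (delta 1%g))) (delta 1%g) =
    rsum (fun g => cdot ((v (delta 1%g) : H) g)
                        (conjc ((u (delta 1%g) : H) g^-1%g))).
  move=> uu; have [_ _ _ adj] := uu.
  rewrite -[LHS]/(ip (u (v (delta 1%g))) (delta 1%g)) adj.
  by rewrite /= /rdot; congr rsum; apply/funext => g; rewrite (adjoint_basis _ uu).
rewrite (E _ _ _ ff) (E _ _ _ hh).
have invg_bij : bijective (fun g : G => g^-1%g).
  by exists (fun g => g^-1%g); exact: invgK.
rewrite -(rsum_reindex _ invg_bij); congr rsum; apply/funext => g.
rewrite invgK !cdotE; move: (_ g) (_ (g^-1)%g) => [a b] [c d] /=; ring.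
Qed.

Lemma rdot_basis_eq0 (x : H) : (forall g c, rdot x (c *: delta g) = 0) -> x = 0.
Proof.
move=> x0; apply/val_inj/funext => g; apply: cdot0 => c.
by rewrite -rdot_basis x0.
Qed.

Lemma rdot0r (x : H) : rdot x 0 = 0.
Proof. exact: (@ip0r _ _ HM). Qed.

(** Cyclicity is that of the matrix trace, entry by entry. An operator
killing the two vectors kills their translates, so its adjoint has zero
coordinates. *)
Lemma tracial_ell2_square : @tracial R G HH
  [:: delta1; delta2].
Proof.
split.
  move=> f f' h h' ff hh; rewrite /trace !big_cons !big_nil !addr0.
  have I1 := @intertwiner_inj1 _ _ HM; have I1' := intertwiner_sym I1.
  have I2 := @intertwiner_inj2 _ _ HM; have I2' := intertwiner_sym I2.
  have split_eq (u v : HH -> HH) : linear u -> forall x : HM, forall y : HM -> HH,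
    u (v (y x)) = u (inj1 (proj1 (v (y x)))) + u (inj2 (proj2 (v (y x)))).
    move=> lu x y; rewrite -(linD lu); congr (u _).
    by apply: injective_projections; rewrite /= ?addr0 ?add0r.
  have tr11 (z : HH) : ip z (delta1) = rdot (proj1 z) (delta 1%g).
    by rewrite /= /ip_prod /= rdot0r addr0.
  have tr22 (z : HH) : ip z (delta2) = rdot (proj2 z) (delta 1%g).
    by rewrite /= /ip_prod /= rdot0r add0r.
  have [lf _ _ _] := ff; have [lh _ _ _] := hh.
  rewrite !(split_eq f h lf) !(split_eq h f lh) !ipDl !tr11 !tr22.
  have c1 := intertwiner_comp (intertwiner_comp I1 ff) I1'.
  have c2 := intertwiner_comp (intertwiner_comp I1 ff) I2'.
  have c3 := intertwiner_comp (intertwiner_comp I2 ff) I1'.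
  have c4 := intertwiner_comp (intertwiner_comp I2 ff) I2'.
  have d1 := intertwiner_comp (intertwiner_comp I1 hh) I1'.
  have d2 := intertwiner_comp (intertwiner_comp I1 hh) I2'.
  have d3 := intertwiner_comp (intertwiner_comp I2 hh) I1'.
  have d4 := intertwiner_comp (intertwiner_comp I2 hh) I2'.
  have := trace_cyclic_ell2 c1 d1; have := trace_cyclic_ell2 c2 d3.
  have := trace_cyclic_ell2 c3 d2; have := trace_cyclic_ell2 c4 d4.
  move=> /= -> -> -> ->.
  by rewrite addrACA.
move=> f f' ff f0; have [lf _ fa adj] := ff.
have f1 : f (delta1) = 0 by apply: f0; rewrite !inE eqxx.
have f2 : f (delta2) = 0 by apply: f0; rewrite !inE eqxx orbT.
have f'0 y : f' y = 0.
  apply: injective_projections; apply: rdot_basis_eq0 => g c.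
    have -> : rdot (f' y).1 (c *: delta g) = ip (f' y) (c *: act g (delta1)).
      rewrite /= /ip_prod /= rtrans_basis (lin0 (rtrans_linear g)) scaler0.
      by rewrite rdot0r addr0.
    rewrite (intertwiner_adjoint _ _ ff) (linZ lf) fa f1.
    by rewrite (lin0 (act_linear g)) scaler0 ip0r.
  have -> : rdot (f' y).2 (c *: delta g) = ip (f' y) (c *: act g (delta2)).
    rewrite /= /ip_prod /= rtrans_basis (lin0 (rtrans_linear g)) scaler0.
    by rewrite rdot0r add0r.
  rewrite (intertwiner_adjoint _ _ ff) (linZ lf) fa f2.
  by rewrite (lin0 (act_linear g)) scaler0 ip0r.
by move=> x; apply: ip_ext => y; rewrite adj f'0 ip0l ip0r.
Qed.

End Ell2Module.

(** * Closures and density in terms of the inner product *)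

Section Topology.
Variables (R : realType) (G : groupType).
Local Notation H := (ell2 R G).
Local Notation HM := (ell2_module R G).
Local Notation HH := (prod_module HM HM).

Lemma ell2_normrE (x : H) : `|x| = (Num.sqrt (rdot x x))%:C%C.
Proof. by rewrite rdotxx. Qed.

Lemma ell2_norm_lt (x : H) (r : R) : 0 < r ->
  (`|x| < r%:C%C) = (rdot x x < r ^+ 2).
Proof.
move=> r0; rewrite ell2_normrE ltcR -[r in LHS]gtr0_norm // -sqrtr_sqr.
by rewrite ltr_sqrt // exprn_gt0.
Qed.

Lemma nbhs_ell2P (x : H) (B : set H) : nbhs x B <->
  exists2 e : R, 0 < e & forall y, rdot (x - y) (x - y) < e -> B y.
Proof.
split.
  move=> /nbhs_ballP[/= r]; rewrite -ball_normE => r0 rB.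
  have rR : r = (complex.Re r)%:C%C by rewrite RRe_real // gtr0_real.
  have r1 : 0 < complex.Re r by rewrite -ltcR -rR.
  exists (complex.Re r ^+ 2) => [|y xy]; first by rewrite exprn_gt0.
  by apply: rB; rewrite /ball_ /= rR ell2_norm_lt.
move=> [e e0 eB]; apply/nbhs_ballP; exists (Num.sqrt e)%:C%C.
  by rewrite /= ltcR sqrtr_gt0.
move=> y; rewrite -ball_normE /= ell2_norm_lt ?sqrtr_gt0 // sqr_sqrtr ?(ltW e0) //.
exact: eB.
Qed.

(** The product topology is the topology of the inner product of the direct
sum, although the norm of the product space is a maximum. *)
Lemma closure_adh (A : set (H * H)) : closure A = adh (E := HH) A.
Proof.
apply/seteqP; split => -[x y].
  move=> cA e e0; have e2 : 0 < e / 2 by lra.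
  have nx : nbhs x [set x' | rdot (x - x') (x - x') < e / 2].
    by apply/nbhs_ell2P; exists (e / 2).
  have ny : nbhs y [set y' | rdot (y - y') (y - y') < e / 2].
    by apply/nbhs_ell2P; exists (e / 2).
  have [|[x' y'] [Axy [/= hx hy]]] := cA
     ([set x' | rdot (x - x') (x - x') < e / 2] `*`
      [set y' | rdot (y - y') (y - y') < e / 2]).
    by exists ([set x' | rdot (x - x') (x - x') < e / 2],
     [set y' | rdot (y - y') (y - y') < e / 2]).
  exists (x', y'); split => //; rewrite /= /ip_prod /=; lra.
move=> aA B [[B1 B2] /= [/nbhs_ell2P[e1 e10 h1] /nbhs_ell2P[e2 e20 h2]] sB].
have [|[x' y'] [Axy lt]] := aA (Num.min e1 e2); first by rewrite lt_min e10.
exists (x', y'); split => //; apply: sB; split => /=.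
  apply: h1; move: lt; rewrite /= /ip_prod /= lt_min => /andP[+ _].
  by apply: le_lt_trans; rewrite lerDl rdot_ge0.
apply: h2; move: lt; rewrite /= /ip_prod /= lt_min => /andP[_].
by apply: le_lt_trans; rewrite lerDr rdot_ge0.
Qed.

Lemma dense_adh (A : set H) : dense A <-> forall x, adh (E := HM) A x.
Proof.
split=> [dA x e e0|aA O [x Ox] oO].
  have nx : nbhs x [set x' | rdot (x - x') (x - x') < e].
    by apply/nbhs_ell2P; exists e.
  have [y [Oy Ay]] := dA _
    (ex_intro _ x (nbhs_singleton (nbhs_interior nx))) (open_interior _).
  by exists y; split => //; exact: (interior_subset Oy).
have : nbhs x O by apply: open_nbhs_nbhs.
move=> /nbhs_ell2P[e e0 h]; have [y [Ay xy]] := aA x e e0.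
by exists y; split => //; exact: h.
Qed.

End Topology.

(** * Right ideals of affiliated operators *)

Section Ideals.
Variables (R : realType) (G : groupType).
Local Notation H := (ell2 R G).
Local Notation HM := (ell2_module R G).
Local Notation HH := (prod_module HM HM).
Local Notation vN := (@intertwiner R G HM HM).
Implicit Types f A B C : HM -> HM.

(** The graph of the affiliated operator that is formally [C] composed with
the inverse of [A]. *)
Definition fraction A C : set (H * H) := adh (E := HH) (range (pairing A C)).

Lemma fraction_affiliated A A' C C' : vN A A' -> vN C C' ->
  (forall x, adh (range A) x) -> affiliated (fraction A C).
Proof.
move=> AA CC dA; have pAC := intertwiner_pairing AA CC.
have sM := submodule_range pAC; have [[M0 MD Ma] cM] := submodule_adh sM.
have td := tracial_ell2_square R G.
split.
- by split => // c p q; exact: MD.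
- move=> x y z Mxy Mxz; apply/eqP; rewrite -subr_eq0; apply/eqP.
  apply: (fraction_single_valued td AA CC).
    move=> w /(dense_range_ker td AA dA) ->; by have [/lin0 -> _ _ _] := CC.
  have := submodB (submodule_adh sM).1 Mxy Mxz.
  by congr (adh _ _); congr (_, _); exact: subrr.
- apply/dense_adh => x; apply: adhS (dA x) => _ [z _ <-].
  by exists (C z); apply: sub_adh; exists z.
- apply/closure_id; rewrite closure_adh; apply/seteqP.
  split; first exact: (@sub_adh _ _ HH).
  exact: cM.
- by move=> g x y; exact: Ma.
Qed.

Lemma affiliated_fraction (T : set (H * H)) : affiliated T ->
  exists A B B', [/\ vN A A, vN B B', forall x, adh (range A) x & T = fraction A B].
Proof.
move=> [[T0 TD] Tv Td Tc Ta].
apply: (@graph_fraction _ _ HM).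
- split; first by split=> [//|c p q|g [x y]]; [exact: TD|exact: Ta].
  by move/closure_id: Tc; rewrite closure_adh => TE p; rewrite [in X in _ -> X]TE.
- by move=> y Ty; exact: Tv Ty T0.
- exact/dense_adh.
Qed.

Lemma aff_mul_fraction f f' A A' C C' : vN f f' -> vN A A' -> vN C C' ->
  aff_mul (opgraph f) (fraction A C) = fraction A (fun z => f (C z)).
Proof.
move=> ff AA CC; rewrite /aff_mul closure_adh.
have AfC := intertwiner_pairing AA (intertwiner_comp CC ff).
have I1 := @intertwiner_inj1 _ _ HM; have I2 := @intertwiner_inj2 _ _ HM.
have Q := intertwiner_add (intertwiner_comp (intertwiner_sym I1) I1)
  (intertwiner_comp (intertwiner_comp (intertwiner_sym I2) ff) I2).
apply/seteqP; split.
  move=> p ap; apply: adh_idem; first exact: submodule_range AfC.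
  apply: adhS ap => -[x z] [y /= Ty]; rewrite /opgraph /= => ->.
  have := adh_image Q Ty; rewrite /= [X in adh _ X](_ : _ = (x, f y)); last first.
    by apply: injective_projections; rewrite /= ?addr0 ?add0r.
  apply: adhS => _ [_ [w _ <-] <-]; exists w => //.
  by apply: injective_projections; rewrite /= ?addr0 ?add0r.
apply: (@adhS _ _ HH (range _)) => _ [z _ <-]; exists (C z) => //.
by apply: sub_adh; exists z.
Qed.

Lemma fraction_comp A A' C C' D D' : vN A A' -> vN C C' -> vN D D' ->
  (forall x, adh (range D) x) ->
  fraction (fun z => A (D z)) (fun z => C (D z)) = fraction A C.
Proof.
move=> AA CC DD dD; apply/seteqP; split.
  by apply: (@adhS _ _ HH (range _) (range _)) => _ [z _ <-]; exists (D z).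
exact: adh_range_comp (intertwiner_pairing AA CC) DD dD.
Qed.

(** One inclusion holds because [e] fixes the range of [f]. For the other,
the Ore condition rewrites [e] times the fraction of [C] by [A] as [f] times
the fraction of [B] by [A D]. *)
Lemma aff_rideal_range_projection f f' : vN f f' ->
  aff_rideal (opgraph f) = aff_rideal (opgraph (proj (E := HM) (adh (range f)))).
Proof.
move=> ff; set e := proj _; have sf := submodule_range ff.
have cf := submodule_adh sf; have ee : vN e e := intertwiner_proj cf.
apply/seteqP; split => _ [T /affiliated_fraction[A [C [C' [AA CC dA ->]]]] <-].
  have fC := intertwiner_comp CC ff.
  exists (fraction A (fun z => f (C z))); first exact: fraction_affiliated AA fC dA.
  rewrite (aff_mul_fraction ff AA CC) (aff_mul_fraction ee AA fC).
  congr (fraction A _); apply/funext => z; apply: (proj_id cf).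
  by apply: sub_adh; exists (C z).
have [D [B [B' [DD BB dD eCD]]]] := ore_condition (tracial_ell2_square R G) CC ff.
have AD := intertwiner_comp DD AA.
have dAD x : adh (range (fun z => A (D z))) x.
  exact: adh_range_comp AA DD dD _ (dA x).
exists (fraction (fun z => A (D z)) B); first exact: fraction_affiliated AD BB dAD.
rewrite (aff_mul_fraction ff AD BB) (aff_mul_fraction ee AA CC).
rewrite -(fraction_comp AA (intertwiner_comp CC ee) DD dD).
by congr (fraction _ _); apply/funext => z; rewrite -eCD.
Qed.

Lemma intertwiner_group_vN f f' : vN f f' -> group_vN f.
Proof.
move=> [lf [M M0 fM] fa _]; split => //.
exists (Num.sqrt M) => x; rewrite !ell2_normrE -rmorphM lecR -sqrtrM //.
by apply: ler_wsqrtr; exact: fM.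
Qed.

(** The complex identity follows from the real one applied to [y] and to
[i y]. *)
Lemma ell2_dot_adjoint f f' (x y : H) : vN f f' ->
  ell2_dot (f x) y = ell2_dot x (f' y).
Proof.
move=> ff; have [_ _ _ adj] := ff; have [lf' _ _ _] := intertwiner_sym ff.
have ImE (u v : H) : complex.Im (ell2_dot u v) = rdot u ('i%C *: v).
  congr rsum; apply/funext => g; rewrite -[('i%C *: v) g]/('i%C * v g).
  by rewrite /cdot; case: (u g) => a b; case: (v g) => c d /=; ring.
apply/eqP; rewrite eq_complex !ImE -(linZ lf'); apply/andP; split; apply/eqP.
  exact: adj.
exact: adj.
Qed.

Lemma range_projection_exists f f' : vN f f' ->
  exists e : H -> H, range_projection (opgraph f) e.
Proof.
move=> ff; have cf := submodule_adh (submodule_range ff).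
have ee : vN (proj (adh (range f))) (proj (adh (range f))) := intertwiner_proj cf.
exists (proj (E := HM) (adh (range f))); split; last first.
  exact: aff_rideal_range_projection ff.
split.
- exact: intertwiner_group_vN ee.
- exact: proj_idem cf.
- by move=> x y; exact: ell2_dot_adjoint ee.
Qed.

Lemma vN_projection_intertwiner (e : H -> H) : vN_projection e -> vN e e.
Proof.
move=> [[le [M eM] ea] _ edot]; split => //; last first.
  by move=> x y; have := congr1 (@complex.Re R) (edot x y).
exists (M ^+ 2) => [|x]; first by rewrite sqr_ge0.
have := eM x; rewrite !ell2_normrE -rmorphM lecR => h.
have := ler_pXn2r (n := 2) (ltn0Sn 1) (sqrtr_ge0 (rdot (e x) (e x)))
  (le_trans (sqrtr_ge0 _) h).
by rewrite h exprMn !sqr_sqrtr ?rdot_ge0.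
Qed.

(** Multiplying [opgraph f] by the identity puts its graph in the right ideal
of [e]; hence [f x] is a limit of vectors in the range of [e], on which [e] is
the identity. *)
Lemma range_projection_id f f' e (x : H) : vN f f' ->
  range_projection (opgraph f) e -> e (f x) = f x.
Proof.
move=> ff [pe ideq]; have ee := vN_projection_intertwiner pe.
have [_ eidem _] := pe; have [le _ _ eadj] := ee.
have dI y : adh (E := HM) (range (fun z : HM => z)) y by apply: sub_adh; exists y.
have II : vN (fun z => z) (fun z => z) := intertwiner_id HM.
pose S := fraction (fun z : HM => z) (fun z => f z).
have : aff_rideal (opgraph f) S.
  exists (fraction (fun z : HM => z) (fun z => z)).
    exact: (fraction_affiliated II II dI).
  exact: (aff_mul_fraction ff II II).
rewrite ideq => -[T _ ST].
have : S (x, f x) by apply: sub_adh; exists x.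
rewrite -ST /aff_mul closure_adh => aS.
apply/eqP; rewrite eq_sym -subr_eq0; apply/eqP/rdot_eq0/eqP.
rewrite eq_le rdot_ge0 andbT; apply/ler_addgt0Pr => r r0; rewrite add0r.
have [[x' z] [[y _]]] := aS r r0; rewrite /opgraph /= => -> lt.
set w := f x - e y.
have -> : f x - e (f x) = w - e w.
  by rewrite /w (linB le) eidem opprB addrA subrK.
apply: le_trans (ltW lt); apply: (@le_trans _ _ (rdot w w)); last first.
  by rewrite /= /ip_prod /= lerDr rdot_ge0.
have E : rdot w (e w) = rdot (e w) (e w).
  by rewrite -[RHS]/(@ip R G HM (e w) (e w)) eadj eidem.
have := @nsqB R G HM w (e w : H); rewrite /= E => ->.
by have := rdot_ge0 (e w); lra.
Qed.

End Ideals.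

(** * The lower bound for the rank *)

Section GroupRingOperators.
Variables (R : realType) (G : groupType).
Local Notation H := (ell2 R G).
Local Notation HM := (ell2_module R G).
Local Notation vN := (@intertwiner R G HM HM).
Local Notation delta g := (ell2_basis R g).

Lemma ltrans_intertwiner (g : G) : vN (@ltrans R G g) (@ltrans R G g^-1%g).
Proof.
have adj x y : rdot (ltrans g x) y = rdot x (ltrans g^-1%g y).
  rewrite /rdot -[RHS](rsum_reindex _ (mulg_bijl g)).
  congr rsum; apply/funext => h /=; congr (cdot _ (y _)).
  by rewrite invgK mulgA mulgV mul1g.
have K x : ltrans g^-1%g (ltrans g x) = x.
  by apply/val_inj/funext => h /=; rewrite invgK mulgA mulVg mul1g.
split.
- by move=> c x y; apply/val_inj/funext.
- by exists 1 => // x; rewrite mul1r /= adj K.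
- by move=> k x; apply/val_inj/funext => h /=; rewrite mulgA.
- exact: adj.
Qed.

Lemma scale_intertwiner (E : hilbert_module R G) (c : R[i]) :
  intertwiner (fun x : E => c *: x) (fun x => conjc c *: x).
Proof.
split.
- by move=> k x y; rewrite scalerDr !scalerA mulrC.
- by exists (normc c ^+ 2) => [|x]; rewrite ?sqr_ge0 // nsqZ.
- by move=> g x; rewrite (linZ (act_linear g)).
- by move=> x y; rewrite ipZ.
Qed.

Lemma sum_intertwiner (E F : hilbert_module R G) (I : Type) (s : seq I)
  (f : I -> E -> F) (f' : I -> F -> E) :
  (forall i, intertwiner (f i) (f' i)) ->
  intertwiner (fun x => \sum_(i <- s) f i x) (fun x => \sum_(i <- s) f' i x).
Proof.
move=> ff; elim: s => [|i s IH].
  have Z (K L : hilbert_module R G) (u : I -> K -> L) :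
      (fun x => \sum_(i <- [::]) u i x) = (fun=> 0).
    by apply/funext => x; rewrite big_nil.
  rewrite !Z; split.
  - by move=> c x y; rewrite scaler0 addr0.
  - by exists 0 => // x; rewrite ip0l mul0r.
  - by move=> g x; rewrite (lin0 (act_linear g)).
  - by move=> x y; rewrite ip0l ip0r.
have := intertwiner_add (ff i) IH.
have S (K L : hilbert_module R G) (u : I -> K -> L) :
    (fun x => \sum_(i <- i :: s) u i x) = (fun x => u i x + \sum_(j <- s) u j x).
  by apply/funext => x; rewrite big_cons.
by rewrite !S.
Qed.

Variable K : divringClosed R[i].
Implicit Types a : group_algebra (subfield K) G.

Lemma galg_act_intertwiner a : exists f', vN (galg_act a) f'.
Proof.
eexists; apply: (@sum_intertwiner HM HM G (finsupp a)
  (fun g x => subfield_val (a g) *: ltrans g x)) => g.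
exact: intertwiner_comp (ltrans_intertwiner g) (scale_intertwiner _ _).
Qed.

Lemma ltrans_basis (g : G) : ltrans g (delta 1%g) = delta g.
Proof.
apply/val_inj/funext => h /=; congr (_%:R); congr nat_of_bool.
apply/eqP/eqP => [h1|->]; last by rewrite mulVg.
by apply: (mulgI g^-1%g); rewrite h1 mulVg.
Qed.

Lemma galg_act_basis a :
  galg_act a (delta 1%g) = \sum_(g <- finsupp a) subfield_val (a g) *: delta g.
Proof. by apply: eq_bigr => g _; rewrite ltrans_basis. Qed.

Lemma galg_act_coeff a g : galg_act a (delta 1%g) g = subfield_val (a g).
Proof.
rewrite galg_act_basis.
have -> : (\sum_(g <- finsupp a) subfield_val (a g) *: delta g) g =
    \sum_(h <- finsupp a) subfield_val (a h) * (g == h)%:R.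
  by elim/big_rec2: _ => [//|h x y _ <-].
have [gs|gs] := boolP (g \in finsupp a).
  rewrite (bigD1_seq g) ?fset_uniq //= eqxx mulr1 big1 ?addr0 // => h hg.
  by rewrite eq_sym (negPf hg) mulr0.
rewrite big_seq big1 => [|h hs]; first by rewrite fsfun_dflt.
by case: eqVneq => [gh|_]; [rewrite gh hs in gs | rewrite mulr0].
Qed.

Lemma galg_act_nsq a : rdot (galg_act a (delta 1%g)) (galg_act a (delta 1%g)) =
  \sum_(g <- finsupp a) normc (subfield_val (a g)) ^+ 2.
Proof.
set x := galg_act a _; rewrite {2}/x galg_act_basis.
have -> (s : seq G) : rdot x (\sum_(g <- s) subfield_val (a g) *: delta g) =
    \sum_(g <- s) rdot x (subfield_val (a g) *: delta g).
  elim: s => [|g s IH]; first by rewrite !big_nil rdot0r.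
  by rewrite !big_cons -IH -[LHS]/(@ip R G HM x (_ + _)) ipDr.
apply: eq_bigr => g _; rewrite rdot_basis galg_act_coeff cdotE normc_sqr.
by rewrite !expr2.
Qed.

(** Its imaginary part is [Re <e delta, i e delta>], which vanishes. *)
Lemma vN_tr_projection (e : H -> H) : vN_projection e ->
  vN_tr e = (rdot (e (delta 1%g)) (e (delta 1%g)))%:C%C.
Proof.
move=> pe; have [_ eidem _] := pe.
have [le _ _ adj] := vN_projection_intertwiner pe.
have sa (c : R[i]) : cdot (vN_tr e) c = rdot (e (delta 1%g)) (c *: e (delta 1%g)).
  by rewrite -rdot_basis -(linZ le) -[RHS]/(@ip R G HM _ _) -adj eidem.
have i0 (x : H) : rdot x ('i%C *: x) = 0.
  have : rdot x ('i%C *: x) = - rdot x ('i%C *: x).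
    have ciE : conjc 'i%C = - 'i%C :> R[i].
      by apply/eqP; rewrite eq_complex /= oppr0 !eqxx.
    by rewrite {1}rdotC rdotZ ciE scaleNr; exact: (@ipNr R G HM).
  lra.
have := sa 1; have := sa 'i%C; rewrite i0 scale1r !cdotE.
by case: (vN_tr e) => u v /=; rewrite !mulr0 !mulr1 add0r addr0 => -> ->.
Qed.

(** The uncertainty principle: a vector fixed by [e] has coordinates bounded
by [|x| (tr e)^(1/2)], so it cannot be concentrated on few points unless
[tr e] is large. *)
Lemma rank_lower_bound a : a != [fsfun] ->
  exists2 t : R, rk (opgraph (galg_act a)) = t%:C%C &
    1 <= (size (finsupp a))%:R * t.
Proof.
move=> a0; have [f' ff] := galg_act_intertwiner a.
rewrite /rk; set e := xget _ _.
have re : range_projection (opgraph (galg_act a)) e.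
  rewrite /e; case: xgetP => [e' _ //|no].
  by have [e' /no] := range_projection_exists ff.
have [pe _] := re; have [_ eidem _] := pe.
have [le _ ea adj] := vN_projection_intertwiner pe.
pose t := rdot (e (delta 1%g)) (e (delta 1%g)).
exists t; first exact: vN_tr_projection.
set x := galg_act a (delta 1%g); have ex : e x = x := range_projection_id _ ff re.
have tg g : rdot (e (delta g)) (e (delta g)) = t.
  rewrite -rtrans_basis (ea g).
  exact: (@act_isometry R G HM).
pose N := rdot x x.
have coeff_le g : normc (subfield_val (a g)) ^+ 2 <= N * t.
  set c := subfield_val (a g).
  have cE : rdot x (c *: e (delta g)) = normc c ^+ 2.
    rewrite -(linZ le) -[LHS]/(@ip R G HM _ _) -adj ex /= rdot_basis galg_act_coeff.
    by rewrite cdotE normc_sqr !expr2.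
  have := @cauchy_schwarz R G HM x (c *: e (delta g)).
  have -> : @ip R G HM (c *: e (delta g)) (c *: e (delta g)) = normc c ^+ 2 * t.
    by rewrite nsqZ -(tg g).
  rewrite /= cE -/N; have [->|c0] := eqVneq (normc c ^+ 2) 0.
    by move=> _; rewrite mulr_ge0 // rdot_ge0.
  rewrite [X in X <= _]expr2 [N * _]mulrCA ler_pM2l //.
  by rewrite lt_def c0 sqr_ge0.
have N0 : 0 < N.
  rewrite lt_def rdot_ge0 andbT; apply: contraNN a0 => /eqP/rdot_eq0 x0.
  apply/eqP/fsfunP => g; rewrite fsfunE; apply: val_inj.
  by rewrite -[LHS]galg_act_coeff -/x x0.
rewrite -(ler_pM2l N0) mulr1 {1}/N galg_act_nsq.
apply: (@le_trans _ _ (\sum_(g <- finsupp a) (N * t))); first exact: ler_sum.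
by rewrite big_const_seq count_predT iter_addr_0 -[_ *+ _]mulr_natl mulrCA lexx.
Qed.

Lemma galg_map_neq0 (theta : {rmorphism subfield K -> subfield K}) a :
  a <> [fsfun] -> galg_map theta a != [fsfun].
Proof.
move=> a0; apply/eqP => ta0; apply: a0; apply/fsfunP => g; rewrite fsfunE.
have [gs|gs] := boolP (g \in finsupp a); last by rewrite fsfun_dflt.
have := congr1 (fun b : group_algebra (subfield K) G => b g) ta0.
by rewrite /galg_map !fsfunE gs => /eqP; rewrite fmorph_eq0 => /eqP.
Qed.

Lemma size_finsupp_galg_map theta a :
  (size (finsupp (galg_map theta a)) <= size (finsupp a))%N.
Proof.
apply: uniq_leq_size; first exact: fset_uniq.
move=> g; rewrite !mem_finsupp /galg_map fsfunE.
by case: ifP; rewrite ?eqxx // mem_finsupp.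
Qed.

End GroupRingOperators.

Theorem proposition5 (R : realType) (G : groupType) (K : divringClosed R[i])
    (alpha : group_algebra (subfield K) G) :
  alpha <> [fsfun] ->
  exists2 eps : R, 0 < eps &
    forall theta : {rmorphism subfield K -> subfield K}, bijective theta ->
      eps%:C%C < rk (opgraph (galg_act (galg_map theta alpha))).
Proof.
move=> alpha0; pose n : R := (size (finsupp alpha))%:R + 1.
have n0 : 0 < n by rewrite ltr_wpDl.
exists n^-1 => [|theta _]; first by rewrite invr_gt0.
have [t -> nt] := rank_lower_bound (galg_map_neq0 theta alpha0).
have t0 : 0 < t.
  rewrite ltNge; apply/negP => t0.
  have := le_trans nt (mulr_ge0_le0 (ler0n R _) t0); lra.
rewrite ltcR -div1r ltr_pdivrMr // mulrC.
apply: (le_lt_trans nt); rewrite ltr_pM2r //.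
apply: le_lt_trans (_ : _ <= (size (finsupp alpha))%:R) _; last by rewrite ltrDl.
by rewrite ler_nat size_finsupp_galg_map.
Qed.
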